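(* For every $P\in\mathbb{F}_q[Y]$ with $\deg P=1$, we have $\mathrm{Sp}([\,\overline P\,])=\{0\}\cup\{q^{-(2+n)}: n\in\mathbb{N}\}$.
   Context: Let $\mathbb{F}_q$ be a finite field with $q$ elements, $R=\mathbb{F}_q[Y]$, $K=\mathbb{F}_q(Y)$, $\widehat K=\mathbb{F}_q((Y^{-1}))$ with absolute value $|x|=q^{-v_\infty(x)}$ ($v_\infty(x)$ = smallest $i$ with $x_i\neq0$ for $x=\sum_ix_iY^{-i}$; so $|P/Q|=q^{\deg P-\deg Q}$). $[\,\overline P\,]$ denotes the element of $\widehat K$ with continued fraction expansion $P+\cfrac{1}{P+\cfrac{1}{P+\cdots}}$; it is a quadratic irrational over $K$. Let $\Gamma=\mathrm{PGL}_2(\mathbb{F}_q[Y])$ acting by homographies on $\widehat K\cup\{\infty\}$; for a quadratic irrational $\alpha$, $\alpha^\sigma$ is its Galois conjugate over $K$; $\Theta_\alpha=\Gamma\cdot\{\alpha,\alpha^\sigma\}$; for $x\in\widehat K-(K\cup\Theta_\alpha)$, $c_\alpha(x)=\liminf_{\beta\in\Theta_\alpha,\,|\beta-\beta^\sigma|\to0}\frac{|x-\beta|}{|\beta-\beta^\sigma|}$; $\mathrm{Sp}(\alpha)=\{c_\alpha(x):x\in\widehat K-(K\cup\Theta_\alpha)\}$. Here $\mathbb{N}=\{0,1,2,\dots\}$. *)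

(* Defs.v *)
From HB Require Import structures.
From mathcomp Require Import all_boot all_order all_algebra.
From mathcomp Require Import all_classical all_reals all_analysis.
From mathcomp Require Import zify.

Set Implicit Arguments.
Unset Strict Implicit.
Unset Printing Implicit Defensive.

Import Order.TTheory GRing.Theory Num.Theory.
Local Open Scope classical_set_scope.
Local Open Scope ring_scope.

(* [x : int -> F] stands for the series [sum_i x_i Y^-i]. *)
Definition is_laurent (F : fieldType) (x : int -> F) : bool :=
  `[< exists m : int, forall i : int, i < m -> x i = 0 >].

Record laurent (F : fieldType) := Laurent {
  lcoef :> int -> F;
  _ : is_laurent lcoef }.

HB.instance Definition _ (F : fieldType) := [isSub for @lcoef F].
HB.instance Definition _ (F : fieldType) := [Choice of laurent F by <:].

Section LaurentRing.
Variable F : fieldType.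
Implicit Types x y z : laurent F.

Lemma lcoef_inj x y : (forall i, x i = y i) -> x = y.
Proof. by move=> e; apply/val_inj/funext => i; exact: e. Qed.

Lemma laurent_bound x : exists m : int, forall i, i < m -> x i = 0.
Proof. by case: x => f /= /asboolP. Qed.

Fact ladd_subproof x y : is_laurent (fun i => x i + y i).
Proof.
apply/asboolP; have [m hm] := laurent_bound x; have [n hn] := laurent_bound y.
exists (Num.min m n) => i; rewrite lt_min => /andP[im im'].
by rewrite hm // hn // addr0.
Qed.
Definition ladd x y := Laurent (ladd_subproof x y).

Fact lopp_subproof x : is_laurent (fun i => - x i).
Proof.
apply/asboolP; have [m hm] := laurent_bound x.
by exists m => i im; rewrite hm // oppr0.
Qed.
Definition lopp x := Laurent (lopp_subproof x).

Fact lmono_subproof (m : int) (c : F) :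
  is_laurent (fun i => if i == m then c else 0).
Proof. by apply/asboolP; exists m => i im; rewrite lt_eqF. Qed.
(* [lmono m c] is [c Y^-m]. *)
Definition lmono m c := Laurent (lmono_subproof m c).

Fact laddA : associative ladd.
Proof. by move=> x y z; apply: lcoef_inj => i /=; rewrite addrA. Qed.
Fact laddC : commutative ladd.
Proof. by move=> x y; apply: lcoef_inj => i /=; rewrite addrC. Qed.
Fact ladd0 : left_id (lmono 0 0) ladd.
Proof. by move=> x; apply: lcoef_inj => i /=; rewrite if_same add0r. Qed.
Fact laddN : left_inverse (lmono 0 0) lopp ladd.
Proof. by move=> x; apply: lcoef_inj => i /=; rewrite if_same addNr. Qed.

HB.instance Definition _ :=
  GRing.isZmodule.Build (laurent F) laddA laddC ladd0 laddN.

Lemma lcoef0 i : (0 : laurent F) i = 0.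
Proof. by rewrite /= if_same. Qed.
Lemma lcoefD x y i : (x + y) i = x i + y i. Proof. by []. Qed.
Lemma lcoefN x i : (- x) i = - x i. Proof. by []. Qed.
Lemma lcoefB x y i : (x - y) i = x i - y i. Proof. by []. Qed.

(* Coefficients of the Cauchy product; the sum has finite support. *)
Definition conv (x y : int -> F) (n : int) : F :=
  \sum_(i \in [set: int]) x i * y (n - i).

Lemma convE (x y : int -> F) (a b : int) (n k : nat) :
  (forall i, i < a -> x i = 0) -> (forall i, i < b -> y i = 0) -> (n < k)%N ->
  conv x y (a + b + n%:Z)
  = \sum_(i < k) x (a + i%:Z) * y (b + n%:Z - i%:Z).
Proof.
move=> hx hy nk; rewrite /conv.
pose s := [seq a + i%:Z | i <- iota 0 k].
have us : uniq s by rewrite map_inj_uniq ?iota_uniq// => i j /addrI[].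
rewrite -(fsbig_widen [set` s]) //=; first last.
  move=> i /= [_ /negP]; rewrite -in_setE mem_setE => nis.
  have [ia|ai] := ltP i a; first by rewrite hx ?mul0r.
  rewrite hy ?mulr0// ltNge; apply/negP => bi; move/negP: nis; apply.
  by apply/mapP; exists `|i - a|%N; rewrite ?mem_iota; lia.
rewrite -fsbig_seq // big_map -[in LHS](subn0 k) -/(index_iota 0 k) big_mkord.
by apply: eq_bigr => i _; congr (_ * y _); lia.
Qed.

Lemma conv_low (x y : int -> F) (a b n : int) :
  (forall i, i < a -> x i = 0) -> (forall i, i < b -> y i = 0) -> n < a + b ->
  conv x y n = 0.
Proof.
move=> hx hy nab; rewrite /conv fsbig1// => i _.
have [ia|ai] := ltP i a; first by rewrite hx ?mul0r.
by rewrite hy ?mulr0//; lia.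
Qed.

Fact lmul_subproof x y : is_laurent (conv x y).
Proof.
apply/asboolP; have [a hx] := laurent_bound x; have [b hy] := laurent_bound y.
by exists (a + b) => i; exact: conv_low.
Qed.
Definition lmul x y := Laurent (lmul_subproof x y).

(* The [k] first coefficients from index [a] on, as a polynomial. *)
Let tr (a : int) (k : nat) (x : int -> F) : {poly F} :=
  \poly_(i < k) x (a + i%:Z).

Let lmulE x y a b n k :
  (forall i, i < a -> x i = 0) -> (forall i, i < b -> y i = 0) -> (n < k)%N ->
  lmul x y (a + b + n%:Z) = (tr a k x * tr b k y)`_n.
Proof.
move=> hx hy nk; rewrite /= (convE hx hy (ltnSn n)) coefM.
apply: eq_bigr => i _; rewrite !coef_poly.
have ni := ltn_ord i.
by rewrite !ifT; [congr (_ * y _)| |]; lia.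
Qed.

Let lmul_low x y a b :
  (forall i, i < a -> x i = 0) -> (forall i, i < b -> y i = 0) ->
  forall i, i < a + b -> lmul x y i = 0.
Proof. by move=> hx hy i; exact: conv_low. Qed.

Let coefM_low (p p' q q' : {poly F}) n :
  (forall i, (i <= n)%N -> p`_i = p'`_i) ->
  (forall i, (i <= n)%N -> q`_i = q'`_i) -> (p * q)`_n = (p' * q')`_n.
Proof.
move=> ep eq; rewrite !coefM; apply: eq_bigr => i _.
by have := ltn_ord i => ni; rewrite ep ?eq //; lia.
Qed.

Let tr_mul x y a b k n :
  (forall i, i < a -> x i = 0) -> (forall i, i < b -> y i = 0) -> (n < k)%N ->
  (tr (a + b) k (lmul x y))`_n = (tr a k x * tr b k y)`_n.
Proof. by move=> hx hy nk; rewrite coef_poly nk (lmulE hx hy nk). Qed.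

Fact lmulA : associative lmul.
Proof.
move=> x y z; apply: lcoef_inj => n.
have [a hx] := laurent_bound x; have [b hy] := laurent_bound y.
have [c hz] := laurent_bound z.
have hxy := lmul_low hx hy; have hyz := lmul_low hy hz.
have [nl|nu] := ltP n (a + b + c).
  by rewrite (lmul_low hxy hz)// (lmul_low hx hyz)// addrA.
have [m ->] : exists m : nat, n = a + b + c + m%:Z.
  by exists `|(n - (a + b + c))%R|%N; lia.
rewrite (lmulE hxy hz (ltnSn m)) -!addrA addrA addrA -(addrA a).
rewrite (lmulE hx hyz (ltnSn m)).
transitivity ((tr a m.+1 x * (tr b m.+1 y * tr c m.+1 z))`_m).
  by apply: coefM_low => // i im; rewrite tr_mul.
rewrite mulrA; apply/esym/coefM_low => // i im; exact: tr_mul.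
Qed.

Fact lmulC : commutative lmul.
Proof.
move=> x y; apply: lcoef_inj => n.
have [a hx] := laurent_bound x; have [b hy] := laurent_bound y.
have [nl|nu] := ltP n (a + b).
  by rewrite (lmul_low hx hy)// (lmul_low hy hx)// addrC.
have [m ->] : exists m : nat, n = a + b + m%:Z.
  by exists `|(n - (a + b))%R|%N; lia.
by rewrite (lmulE hx hy (ltnSn m)) (addrC a) (lmulE hy hx (ltnSn m)) mulrC.
Qed.

Lemma lmul_monol m c x n : lmul (lmono m c) x n = c * x (n - m).
Proof.
rewrite /= /conv -(fsbig_widen [set m])//=; last first.
  by move=> i /= [_ /eqP/negbTE ->]; rewrite mul0r.
by rewrite fsbig_set1 eqxx.
Qed.

Fact lmul1 : left_id (lmono 0 1) lmul.
Proof.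
by move=> x; apply: lcoef_inj => n; rewrite lmul_monol mul1r subr0.
Qed.

Fact lmulDl : left_distributive lmul ladd.
Proof.
move=> x y z; apply: lcoef_inj => n.
have [a hx] := laurent_bound x; have [b hy] := laurent_bound y.
have [c hz] := laurent_bound z.
pose d := Num.min a b.
have hx' i : i < d -> x i = 0 by rewrite lt_min => /andP[/hx].
have hy' i : i < d -> y i = 0 by rewrite lt_min => /andP[_ /hy].
have hxy i : i < d -> ladd x y i = 0 by move=> h; rewrite /= hx' ?hy' ?addr0.
rewrite [RHS]/=.
have [nl|nu] := ltP n (d + c).
  by rewrite (lmul_low hxy hz)// (conv_low hx' hz)// (conv_low hy' hz)// addr0.
have [m ->] : exists m : nat, n = d + c + m%:Z.
  by exists `|(n - (d + c))%R|%N; lia.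
rewrite /= (convE hxy hz (ltnSn m)) (convE hx' hz (ltnSn m)).
rewrite (convE hy' hz (ltnSn m)) -big_split /=.
by apply: eq_bigr => i _; rewrite mulrDl.
Qed.

Fact lone_neq0 : lmono 0 1 != 0 :> laurent F.
Proof.
apply/eqP => /(congr1 (fun x : laurent F => x 0)).
by rewrite lcoef0 /= => /eqP; rewrite oner_eq0.
Qed.

HB.instance Definition _ := GRing.Zmodule_isComNzRing.Build (laurent F)
  lmulA lmulC lmul1 lmulDl lone_neq0.

Lemma lcoefM x y n : (x * y) n = conv x y n. Proof. by []. Qed.
Lemma lcoef1 n : (1 : laurent F) n = (n == 0)%:R.
Proof. by rewrite /=; case: eqP. Qed.
Lemma lcoef_sum (I : Type) (s : seq I) (P : pred I) (f : I -> laurent F) n :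
  (\sum_(i <- s | P i) f i) n = \sum_(i <- s | P i) f i n.
Proof. by elim/big_rec2: _ => [|i ? ? _ <-]; rewrite ?lcoef0. Qed.

Let ltpow (w : laurent F) k : (forall i, i < 1 -> w i = 0) ->
  forall i, i < k%:Z -> (w ^+ k) i = 0.
Proof.
move=> hw; elim: k => [|k IH] i ik.
  by rewrite expr0 lcoef1 lt_eqF.
rewrite exprS; apply: (lmul_low hw IH); lia.
Qed.

Let lunit_inv (w : laurent F) : (forall i, i < 1 -> w i = 0) ->
  exists u, (1 - w) * u = 1.
Proof.
move=> hw.
pose f (n : int) : F := if n < 0 then 0 else (\sum_(k < `|n|.+1) w ^+ k) n.
have fP : is_laurent f by apply/asboolP; exists 0 => i; rewrite /f => ->.
have fE n N : n <= N%:Z -> f n = (\sum_(k < N.+1) w ^+ k) n.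
  move=> nN; rewrite /f; case: ltP => n0.
    rewrite lcoef_sum big1// => k _; apply: ltpow => //.
    by apply: lt_le_trans n0 _; lia.
  rewrite !lcoef_sum -!(big_mkord xpredT (fun k => (w ^+ k) n)).
  rewrite [RHS](@big_cat_nat _ _ _ `|n|.+1) //=; last by lia.
  rewrite [X in _ = _ + X]big1_seq ?addr0// => k /=.
  by rewrite mem_index_iota => /andP[nk _]; apply: ltpow => //; lia.
exists (Laurent fP); apply: lcoef_inj => n.
have h1w i : i < 0 -> (1 - w) i = 0.
  by move=> i0; rewrite lcoefB lcoef1 lt_eqF// hw ?subr0//; lia.
have hf i : i < 0 -> (Laurent fP) i = 0 by rewrite /= /f => ->.
have [n0|n0] := ltP n 0.
  by rewrite (lmul_low h1w hf)// lcoef1 lt_eqF.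
have [m ->] : exists m : nat, n = m%:Z by exists `|n|%N; lia.
pose S := \sum_(k < m.+1) w ^+ k.
have hS i : i < 0 -> S i = 0.
  move=> i0; rewrite lcoef_sum big1// => k _; apply: ltpow => //.
  by apply: lt_le_trans i0 _; lia.
transitivity (((1 - w) * S) m%:Z).
  rewrite -[m%:Z]add0r -[0]addr0 (lmulE h1w hf (ltnSn m)).
  rewrite (lmulE h1w hS (ltnSn m)).
  apply: coefM_low => // i im; rewrite !coef_poly ltnS im /=.
  by rewrite (fE _ m)// add0r lez_nat.
have -> : (1 - w) * S = 1 - w ^+ m.+1 by rewrite /S -opprB mulNr -subrX1 opprB.
by rewrite lcoefB [X in _ - X]ltpow ?subr0// ltz_nat.
Qed.

Lemma laurent_val x : x != 0 ->
  exists v : int, x v != 0 /\ forall i, i < v -> x i = 0.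
Proof.
move=> x0; have [m hm] := laurent_bound x.
have [n xn] : exists n : nat, x (m + n%:Z) != 0.
  apply: contrapT => /forallNP h; move/eqP: x0; apply; apply: lcoef_inj => i.
  rewrite lcoef0; have [/hm//|mi] := ltP i m.
  have /negP := h `|i - m|%N; rewrite negbK => /eqP <-; congr (x _); lia.
have ex : exists n : nat, x (m + n%:Z) != 0 by exists n.
case: (ex_minnP ex) => k xk kmin.
exists (m + k%:Z); split => // i ik.
have [/hm//|mi] := ltP i m; apply/eqP/negPn/negP => xi.
have := kmin `|i - m|%N; rewrite (_ : m + _ = i); last by lia.
by move=> /(_ xi); lia.
Qed.

Lemma lmono_mul m n c d : lmono m c * lmono n d = lmono (m + n) (c * d).
Proof.
apply: lcoef_inj => i; rewrite lmul_monol /=.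
by rewrite subr_eq (addrC n); case: eqP; rewrite ?mulr0.
Qed.

Lemma laurent_inv_ex x : x != 0 -> exists y, y * x = 1.
Proof.
move=> /laurent_val[v [xv0 xv]].
pose w := 1 - lmono (- v) (x v)^-1 * x.
have hw i : i < 1 -> w i = 0.
  move=> i1; rewrite lcoefB lmul_monol lcoef1 opprK.
  have [->|i0] := eqVneq i 0; first by rewrite add0r mulVf ?subrr.
  by rewrite (xv (i + v)) ?mulr0 ?subr0//; lia.
have [u] := lunit_inv hw; rewrite /w opprB addrCA subrr addr0 => e.
by exists (u * lmono (- v) (x v)^-1); rewrite -mulrA mulrC.
Qed.

Definition linv x : laurent F :=
  if x == 0 then 0 else xget 0 [set y | y * x = 1].

Fact lmulV x : x != 0 -> linv x * x = 1.
Proof.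
move=> x0; rewrite /linv (negbTE x0); have [y yx] := laurent_inv_ex x0.
by case: xgetP => [z _ //|/(_ y)]; case.
Qed.

Fact linv0 : linv 0 = 0. Proof. by rewrite /linv eqxx. Qed.

HB.instance Definition _ := GRing.ComNzRing_isField.Build (laurent F) lmulV linv0.

End LaurentRing.

Section Embeddings.
Variable F : fieldType.

Fact poly_laurent_subproof (p : {poly F}) :
  is_laurent (fun i : int => if i <= 0 then p`_(`|i|%N) else 0).
Proof.
apply/asboolP; exists (- (size p)%:Z) => i ip.
have pi : (size p <= `|i|)%N by lia.
by rewrite ifT; [rewrite nth_default|lia].
Qed.
Definition poly_laurent (p : {poly F}) : laurent F :=
  Laurent (poly_laurent_subproof p).

Fact poly_laurent_is_zmod_morphism : zmod_morphism poly_laurent.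
Proof.
by move=> p q; apply: lcoef_inj => i /=; case: ifP; rewrite ?coefB ?subr0.
Qed.
HB.instance Definition _ := GRing.isZmodMorphism.Build {poly F} (laurent F)
  poly_laurent poly_laurent_is_zmod_morphism.

Lemma poly_laurentMX (c : F) n :
  poly_laurent (c *: 'X^n) = lmono (- n%:Z) c.
Proof.
apply: lcoef_inj => i /=; rewrite coefZ coefXn.
case: leP => i0; last by rewrite gt_eqF//; lia.
have -> : (`|i|%N == n) = (i == - n%:Z) by lia.
by case: eqP; rewrite ?mulr1 ?mulr0.
Qed.

Fact poly_laurent_is_monoid_morphism : monoid_morphism poly_laurent.
Proof.
split.
  by rewrite -[X in poly_laurent X]scale1r -(expr0 'X) poly_laurentMX.
move=> p q; rewrite -[p]coefK -[q]coefK !poly_def.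
rewrite mulr_suml !raddf_sum /= mulr_suml; apply: eq_bigr => i _.
rewrite mulr_sumr raddf_sum /= mulr_sumr; apply: eq_bigr => j _.
rewrite -scalerAl -scalerAr scalerA -exprD !poly_laurentMX lmono_mul.
by congr (lmono _ _); lia.
Qed.
HB.instance Definition _ := GRing.isMonoidMorphism.Build {poly F} (laurent F)
  poly_laurent poly_laurent_is_monoid_morphism.

Lemma poly_laurent_eq0 p : (poly_laurent p == 0) = (p == 0).
Proof.
apply/eqP/eqP => [e|->]; last exact: raddf0.
apply/polyP => i; move/(congr1 (fun x : laurent F => x (- i%:Z))): e.
by rewrite lcoef0 /= oppr_le0 coef0 abszN.
Qed.

Definition frac_laurent (x : {fraction {poly F}}) : laurent F :=
  poly_laurent (repr x).1 / poly_laurent (repr x).2.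

Lemma fraction_numden (x : {fraction {poly F}}) :
  x = tofrac (repr x).1 / tofrac (repr x).2.
Proof.
have d0 := denom_ratioP (repr x).
apply: (canRL (mulfK _)); first by rewrite tofrac_eq0.
rewrite -{1}[x]reprK /tofrac; unlock FracField.tofrac.
rewrite -[LHS]FracField.pi_mul; apply/eqmodP.
rewrite /= FracField.equivfE /FracField.mulf.
by rewrite !numden_Ratio ?mulf_neq0 ?oner_eq0// !mulr1 mulrC.
Qed.

Lemma frac_laurentE (n d : {poly F}) : d != 0 ->
  frac_laurent (tofrac n / tofrac d) = poly_laurent n / poly_laurent d.
Proof.
move=> d0; rewrite /frac_laurent; set x := tofrac n / tofrac d.
have d'0 := denom_ratioP (repr x).
have : tofrac (n * (repr x).2) = tofrac ((repr x).1 * d).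
  by rewrite !rmorphM /=; apply/eqP; rewrite -eqr_div ?tofrac_eq0// -fraction_numden.
move/eqP; rewrite tofrac_eq => /eqP e.
by apply/eqP; rewrite eqr_div ?poly_laurent_eq0// -!rmorphM /= e.
Qed.

Fact frac_laurent_is_zmod_morphism : zmod_morphism frac_laurent.
Proof.
move=> x y; have dx := denom_ratioP (repr x); have dy := denom_ratioP (repr y).
rewrite {1}[x]fraction_numden {1}[y]fraction_numden -mulNr addf_div ?tofrac_eq0//.
rewrite -rmorphN -!rmorphM -rmorphD /= frac_laurentE ?mulf_neq0//.
rewrite /frac_laurent -mulNr addf_div ?poly_laurent_eq0//.
by rewrite !(rmorphD, rmorphM, rmorphN).
Qed.
HB.instance Definition _ := GRing.isZmodMorphism.Build
  {fraction {poly F}} (laurent F) frac_laurent frac_laurent_is_zmod_morphism.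

Fact frac_laurent_is_monoid_morphism : monoid_morphism frac_laurent.
Proof.
split.
  by rewrite -[1](@mulfV _ (tofrac 1)) ?tofrac_eq0 ?oner_eq0// frac_laurentE
    ?oner_eq0// divff// poly_laurent_eq0 oner_eq0.
move=> x y; have dx := denom_ratioP (repr x); have dy := denom_ratioP (repr y).
rewrite {1}[x]fraction_numden {1}[y]fraction_numden mulf_div.
rewrite -!rmorphM /= frac_laurentE ?mulf_neq0// /frac_laurent.
by rewrite mulf_div !rmorphM.
Qed.
HB.instance Definition _ := GRing.isMonoidMorphism.Build
  {fraction {poly F}} (laurent F) frac_laurent frac_laurent_is_monoid_morphism.

End Embeddings.

Section AbsoluteValue.
Variables (R : realType) (F : finFieldType).

(* The smallest index of a nonzero coefficient; junk value [0] at the zero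
   series, whose absolute value is set separately. *)
Definition lval (x : laurent F) : int :=
  xget 0 [set v : int | x v != 0 /\ forall i : int, i < v -> x i = 0].

Definition labs (x : laurent F) : R :=
  if x == 0 then 0 else #|F|%:R ^ (- lval x).

Lemma lvalP (x : laurent F) : x != 0 ->
  x (lval x) != 0 /\ forall i, i < lval x -> x i = 0.
Proof.
by move=> /laurent_val[v vP]; rewrite /lval; case: xgetP => [w _ //|/(_ v)].
Qed.

Let q_gt1 : 1 < #|F|%:R :> R.
Proof. by rewrite ltr1n; exact: card_finNzRing_gt1. Qed.

Lemma labs_le (x : laurent F) (n : int) :
  labs x <= #|F|%:R ^ (- n) <-> forall i : int, i < n -> x i = 0.
Proof.
rewrite /labs; have [->|x0] := eqVneq x 0.
  split=> [_ i _|_]; first exact: lcoef0.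
  by rewrite exprz_ge0// ler0n.
have [xv xlt] := lvalP x0; rewrite ler_eXz2l// lerN2.
split=> [nv i ni|h]; first by apply: xlt; exact: lt_le_trans ni nv.
by rewrite leNgt; apply/negP => /h e; rewrite e eqxx in xv.
Qed.

End AbsoluteValue.

Section Topology.
Variable F : finFieldType.

(* Neighbourhoods for the topology of the absolute value: see [laurent_nbhsE]. *)
Definition laurent_nbhs (x : laurent F) : set_system (laurent F) :=
  filter_from [set: int]
    (fun n => [set y : laurent F | forall i : int, i < n -> y i = x i]).

HB.instance Definition _ := hasNbhs.Build (laurent F) laurent_nbhs.

Lemma laurent_nbhsE (R : realType) (x : laurent F) :
  nbhs x = filter_from [set e : R | 0 < e]
             (fun e => [set y | labs R (y - x) < e]).
Proof.
have q1 : 1 < #|F|%:R :> R by rewrite ltr1n; exact: card_finNzRing_gt1.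
have q0 : 0 < #|F|%:R :> R by exact: lt_trans q1.
have agree (y : laurent F) n :
    labs R (y - x) <= #|F|%:R ^ (- n) <-> forall i : int, i < n -> y i = x i.
  rewrite labs_le; split=> h i /h; rewrite lcoefB; last by move=> ->; rewrite subrr.
  by move/eqP; rewrite subr_eq0 => /eqP.
apply/seteqP; split=> A [].
  move=> n _ nA; exists (#|F|%:R ^ (- n)); first exact: exprz_gt0.
  by move=> y /ltW /agree; exact: nA.
move=> e /= e0 eA.
have [n ne] : exists n : nat, #|F|%:R ^- n < e.
  exists (Num.bound e^-1); rewrite invf_plt ?posrE ?exprn_gt0//.
  have e'0 : 0 <= e^-1 by rewrite invr_ge0 ltW.
  apply: lt_trans (archi_boundP e'0) _.
  by rewrite -natrX ltr_nat ltn_expl// -(ltr_nat R).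
exists n%:Z => // y /agree yx; apply: eA => /=; apply: le_lt_trans yx _.
by rewrite -exprnN.
Qed.

(* [convergent a n] is [a_0 + 1/(a_1 + 1/(... + 1/a_n))]. *)
Fixpoint convergent (a : nat -> {poly F}) (n : nat) : laurent F :=
  if n is m.+1
  then poly_laurent (a 0%N) + (convergent (fun k => a k.+1) m)^-1
  else poly_laurent (a 0%N).

(* [[a_0, a_1, a_2, ...]], the limit of the convergents. *)
Definition cfrac (a : nat -> {poly F}) : laurent F :=
  xget 0 [set x | convergent a @ \oo --> x].

End Topology.

Section Homographies.
Variable F : finFieldType.

(* [a] is quadratic over [F(Y)] with minimal polynomial [(X - a) (X - b)]. *)
Definition galois_conjugates (a b : laurent F) : Prop :=
  exists p : {poly {fraction {poly F}}},
    [/\ irreducible_poly p, size p = 3%N &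
        map_poly (@frac_laurent F) p = ('X - a%:P) * ('X - b%:P)].

(* The conjugate of a quadratic irrational; junk value [0] on other series. *)
Definition gconj (a : laurent F) : laurent F :=
  xget 0 [set b | galois_conjugates a b].

(* Homographies of the projective line, with [None] the point at infinity. *)
Definition homography (g : 'M[{poly F}]_2) (z : option (laurent F)) :
    option (laurent F) :=
  let e i j := poly_laurent (g i j) in
  if z is Some x then
    if e 1 0 * x + e 1 1 == 0 then None
    else Some ((e 0 0 * x + e 0 1) / (e 1 0 * x + e 1 1))
  else if e 1 0 == 0 then None else Some (e 0 0 / e 1 0).

(* The union of the orbits of [a] and of its conjugate. An element of
   [PGL_2(F[Y])] is given by a representative in [GL_2(F[Y])]; scalar matrices
   act trivially. Orbits of irrational points do not contain infinity. *)
Definition Theta (a : laurent F) : set (laurent F) :=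
  [set b | exists2 g : 'M[{poly F}]_2, g \in unitmx &
     homography g (Some a) = Some b \/ homography g (Some (gconj a)) = Some b].

End Homographies.

Section Spectrum.
Variables (R : realType) (F : finFieldType).

(* The filter of [b] in [Theta a] with [|b - gconj b|] tending to [0]. *)
Definition Theta_filter (a : laurent F) : set_system (laurent F) :=
  filter_from [set e : R | 0 < e]
    (fun e => [set b | Theta a b /\ labs R (b - gconj b) < e]).

Definition approx_const (a x : laurent F) : \bar R :=
  limf_einf (fun b => (labs R (x - b) / labs R (b - gconj b))%:E)
            (Theta_filter a).

Definition spectrum (a : laurent F) : set (\bar R) :=
  [set approx_const a x | x in
    ~` (range (@frac_laurent F) `|` Theta a)].

End Spectrum.

Arguments spectrum R {F} a.

(* Main.v *)
(* Put al = [P, P, ...] = P + 1/al, so al' = -1/al lies in the orbit of al and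
   Theta is the orbit of al alone. Expand x as a continued fraction with partial
   quotients a_k, complete quotients y_k and convergent denominators r_k. For
   b = g_k(u al), where x = g_k(y_{k+1}) and u is a constant,
     |x - b| / |b - b'| = q^-2 (|y_{k+1} - u al| / |y_{k+1}|)
                               (|u r_{k+1} - r_k al| / |r_{k+1}|),
   and the two factors measure how long the partial quotients after,
   respectively before, index k agree with u^(+-1) P. Only these b matter: if
   |x - b| / |b - b'| < q^-2, the norm form of al takes values in F at two
   consecutive convergents, so b = g_k(u al) because every unit of F[Y][al] is
   a constant times a power of al. Since some a_k differs from P arbitrarily
   far, the ratio is at most q^-2 infinitely often; lengthening the blocks of P
   in x between quotients P^2 or P + 1 realizes every smaller power of q
   and 0. *)

Require Import Defs.
From mathcomp Require Import all_boot all_order all_algebra.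
From mathcomp Require Import all_classical all_reals all_analysis.
From mathcomp Require Import zify ring.

Set Implicit Arguments.
Unset Strict Implicit.
Unset Printing Implicit Defensive.

Import Order.TTheory GRing.Theory Num.Theory.
Local Open Scope classical_set_scope.
Local Open Scope ring_scope.

Local Notation pl := (@poly_laurent _).

(** * The degree of a Laurent series, the logarithm of its absolute value *)

Section Degree.
Variable F : fieldType.
Implicit Types (x y z : laurent F) (p : {poly F}) (m n : int).

(* Unlike [deg x <= n], this is also correct at [x = 0]. *)
Definition dle x n : bool := `[< forall i : int, i < - n -> x i = 0 >].

(* [labs x = q ^ deg x] for [x != 0]; [deg 0] is junk. *)
Definition deg x : int := xget 0 [set n : int | x (- n) != 0 /\ dle x n].

Lemma dleP x n : reflect (forall i : int, i < - n -> x i = 0) (dle x n).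
Proof. exact: asboolP. Qed.

Lemma deg_unique x n : x (- n) != 0 -> dle x n -> deg x = n.
Proof.
move=> xn /dleP hx; rewrite /deg; apply: xget_subset1.
  by split=> //; apply/dleP.
move=> a b /= [xa /dleP ha] [xb /dleP hb].
case: (ltgtP a b) => // h.
  by move: xb; rewrite ha ?eqxx// ltrN2.
by move: xa; rewrite hb ?eqxx// ltrN2.
Qed.

Lemma degP x : x != 0 -> x (- deg x) != 0 /\ dle x (deg x).
Proof.
move=> /laurent_val[v [xv hv]].
have h : dle x (- v) by apply/dleP => i; rewrite opprK; exact: hv.
by rewrite (@deg_unique x (- v)) ?opprK.
Qed.

Lemma deg_coef x : x != 0 -> x (- deg x) != 0.
Proof. by move=> /degP[]. Qed.

Lemma dle_deg x : dle x (deg x).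
Proof.
have [->|/degP[]//] := eqVneq x 0.
by apply/dleP => i _; exact: lcoef0.
Qed.

Lemma dle0 n : dle 0 n. Proof. by apply/dleP => i _; exact: lcoef0. Qed.

Lemma dle_trans x m n : dle x m -> m <= n -> dle x n.
Proof. by move=> /dleP h mn; apply/dleP => i hi; apply: h; lia. Qed.

Lemma dle_le x n : x != 0 -> dle x n -> deg x <= n.
Proof.
move=> x0 /dleP h; rewrite leNgt; apply/negP => nd.
by move: (deg_coef x0); rewrite h ?eqxx// ltrN2.
Qed.

Lemma dleD x y n : dle x n -> dle y n -> dle (x + y) n.
Proof. by move=> /dleP hx /dleP hy; apply/dleP => i hi; rewrite lcoefD hx ?hy ?addr0. Qed.

Lemma dleN x n : dle x n -> dle (- x) n.
Proof. by move=> /dleP hx; apply/dleP => i hi; rewrite lcoefN hx ?oppr0. Qed.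

Lemma dleB x y n : dle x n -> dle y n -> dle (x - y) n.
Proof. by move=> hx hy; apply: dleD => //; exact: dleN. Qed.

Lemma dleM x y m n : dle x m -> dle y n -> dle (x * y) (m + n).
Proof. by move=> /dleP hx /dleP hy; apply/dleP => i hi; apply: (conv_low hx hy); lia. Qed.

Lemma dle_all x : (forall k : nat, dle x (- k%:Z)) -> x = 0.
Proof.
by move=> h; apply: lcoef_inj => i; rewrite lcoef0; apply: (dleP _ _ (h `|i|.+1)); lia.
Qed.

Lemma degM x y : x != 0 -> y != 0 -> deg (x * y) = deg x + deg y.
Proof.
move=> x0 y0; apply: deg_unique; last by apply: dleM; exact: dle_deg.
rewrite opprD -[X in (x * y) X]addr0 lcoefM.
rewrite (convE (k := 1) (dleP _ _ (dle_deg x)) (dleP _ _ (dle_deg y)) (ltnSn 0)) big_ord1.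
by rewrite subr0 !addr0 mulf_neq0 ?deg_coef.
Qed.

Lemma deg1 : deg (1 : laurent F) = 0.
Proof.
apply: deg_unique => [|]; first by rewrite lcoef1 oppr0 eqxx oner_neq0.
by apply/dleP => i i0; rewrite lcoef1 lt_eqF// -oppr0.
Qed.

Lemma degV x : x != 0 -> deg x^-1 = - deg x.
Proof.
move=> x0; have : deg (x^-1 * x) = deg x^-1 + deg x by rewrite degM ?invr_eq0.
by rewrite mulVf// deg1; lia.
Qed.

Lemma dle_inv_large x : 1 <= deg x -> dle x^-1 (- 1).
Proof.
have [->|x0 h] := eqVneq x 0; first by rewrite invr0 dle0.
by apply: dle_trans (dle_deg _) _; rewrite degV//; lia.
Qed.

Lemma deg_div x y : x != 0 -> y != 0 -> deg (x / y) = deg x - deg y.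
Proof. by move=> x0 y0; rewrite degM ?invr_eq0// degV. Qed.

Lemma degN x : deg (- x) = deg x.
Proof.
have [->|x0] := eqVneq x 0; first by rewrite oppr0.
apply: deg_unique; last by apply: dleN; exact: dle_deg.
by rewrite lcoefN oppr_eq0 deg_coef.
Qed.

Lemma degX x (k : int) : x != 0 -> deg (x ^ k) = k * deg x.
Proof.
move=> x0.
have hn (n : nat) : deg (x ^+ n) = n%:Z * deg x.
  elim: n => [|n IH]; first by rewrite expr0 deg1 mul0r.
  by rewrite exprS degM ?expf_neq0// IH; lia.
case: k => n; first exact: hn.
by rewrite NegzE -exprnN degV ?expf_neq0// hn; lia.
Qed.

(** The ultrametric equality: the coefficient at [- deg x] receives nothing from [y]. *)
Lemma deg_lead x y n : x != 0 -> dle y n -> n < deg x ->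
  x + y != 0 /\ deg (x + y) = deg x.
Proof.
move=> x0 hy nx; have /dleP hy' := hy.
have c : (x + y) (- deg x) != 0.
  by rewrite lcoefD hy' ?addr0 ?deg_coef// ltrN2.
split; first by apply: contra c => /eqP ->; rewrite lcoef0.
by apply: deg_unique => //; apply: dleD (dle_deg _) (dle_trans hy (ltW nx)).
Qed.

Lemma poly_laurent_coef p i :
  pl p i = if i <= 0 then p`_`|i|%N else 0.
Proof. by []. Qed.

Lemma dle_poly p : dle (pl p) ((size p)%:Z - 1).
Proof.
apply/dleP => i hi /=; case: ifP => // i0.
have sp : (size p <= `|i|)%N by lia.
by rewrite nth_default.
Qed.

Lemma deg_poly p : p != 0 -> deg (pl p) = (size p)%:Z - 1.
Proof.
move=> p0; apply: deg_unique; last exact: dle_poly.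
have sp : (0 < size p)%N by rewrite size_poly_gt0.
have e : `|- ((size p)%:Z - 1)|%N = (size p).-1 by lia.
by rewrite poly_laurent_coef ifT; [rewrite e -/(lead_coef p) lead_coef_eq0|lia].
Qed.

Lemma poly_laurent_neq0 p : (pl p != 0) = (p != 0).
Proof. by rewrite poly_laurent_eq0. Qed.

Lemma deg_poly_ge0 p : p != 0 -> 0 <= deg (pl p).
Proof.
move=> p0; rewrite deg_poly//; have : (0 < size p)%N by rewrite size_poly_gt0.
by lia.
Qed.

(** The polynomial collects the terms of nonpositive index; it serves as the floor in the continued
    fraction algorithm. *)
Lemma laurent_floor x : exists p, dle (x - pl p) (- 1).
Proof.
exists (\poly_(i < `|deg x|.+1) x (- i%:Z)); apply/dleP => i hi.
rewrite lcoefB poly_laurent_coef coef_poly ifT; last by lia.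
case: ifP => h; first by rewrite (_ : - _ = i) ?subrr//; lia.
by rewrite subr0; apply: (dleP _ _ (dle_deg x)); lia.
Qed.

End Degree.

Arguments deg : simpl never.

Lemma labsE (R : realType) (F : finFieldType) (x : laurent F) :
  x != 0 -> labs R x = #|F|%:R ^ deg x.
Proof.
move=> x0; rewrite /labs (negbTE x0); congr (_ ^ _).
have [xv hv] := lvalP x0; apply/esym/deg_unique; first by rewrite opprK.
by apply/dleP => i; rewrite opprK; exact: hv.
Qed.

(** * The norm form of [al] and the units of F[Y][al] *)

Section GoldenUnits.
Variables (F : fieldType) (P : {poly F}) (al : laurent F).
Hypotheses (hP : size P = 2%N) (hal : al = pl P + al^-1) (dal : deg al = 1).
Implicit Types (c d : {poly F}).

(* The norm of [c al + d] over [F(Y)]. *)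
Definition nform c d := d ^+ 2 + c * d * P - c ^+ 2.

Lemma al_neq0 : al != 0.
Proof.
apply/negP => /eqP al0; move: hal; rewrite al0 invr0 addr0 => /esym/eqP.
by rewrite poly_laurent_eq0 -size_poly_eq0 hP.
Qed.

Lemma al_sqr : al ^+ 2 = pl P * al + 1.
Proof. by rewrite expr2 {1}hal mulrDl mulVf// al_neq0. Qed.

Lemma size_le1_const c : c != 0 -> (size c <= 1)%N ->
  exists2 u : F, u != 0 & c = u%:P.
Proof.
move=> c0 /size1_polyC e; exists c`_0 => //.
by apply: contra c0 => /eqP u0; rewrite e u0 polyC0.
Qed.

(** Descent on the sizes of [c] and [d]. If [c] is smaller, multiply by [al]; if [d] is smaller,
    divide by [al]: the norm only changes sign and the larger coefficient is replaced by a smaller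
    one. Equal sizes are excluded by the term [c * d * P]. *)
Lemma nform_units c d : (c != 0) || (d != 0) -> (size (nform c d) <= 1)%N ->
  exists2 u : F, u != 0 & exists k : int, pl c * al + pl d = pl u%:P * al ^ k.
Proof.
have [n] := ubnP (size c + size d)%N; elim: n c d => // n IH c d hn hcd hN.
have al0 := al_neq0; have al2 := al_sqr.
have szM (p q : {poly F}) : p != 0 -> q != 0 ->
  size (p * q) = (size p + size q).-1 by exact: size_mul.
have szD (p q : {poly F}) : (size (p + q)%R <= maxn (size p) (size q))%N.
  exact: size_polyD.
have szN (p : {poly F}) : size (- p) = size p by exact: size_polyN.
have P0 : P != 0 by rewrite -size_poly_eq0 hP.
have sq (p : {poly F}) : p != 0 -> size (p ^+ 2) = (size p + size p).-1.
  by move=> p0; rewrite expr2 szM.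
have [c0|c0] := eqVneq c 0.
  move: hN hcd; rewrite c0 eqxx /= /nform expr0n /= subr0 !mul0r addr0 => hN d0.
  have [|u u0 ->] := size_le1_const d0; first by move: hN; rewrite sq//; lia.
  by exists u => //; exists 0; rewrite expr0z raddf0 mul0r add0r mulr1.
have [d0|d0] := eqVneq d 0.
  move: hN; rewrite d0 /nform expr0n /= mulr0 mul0r !add0r szN => hN.
  have [|u u0 ->] := size_le1_const c0; first by move: hN; rewrite sq//; lia.
  by exists u => //; exists 1; rewrite expr1z raddf0 addr0.
have sc : (0 < size c)%N by rewrite size_poly_gt0.
have sd : (0 < size d)%N by rewrite size_poly_gt0.
have [scd|sdc|ecd] := ltngtP (size c) (size d).
- pose e := d + c * P.
  have hde : d * e = nform c d + c ^+ 2 by rewrite /nform /e; ring.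
  (* As the norm is constant, [d * e] has at most the size of [c ^+ 2], and [c] is the smaller
     coefficient. *)
  have se : (size e < size d)%N.
    have [->|e0] := eqVneq e 0; first by rewrite size_poly0.
    have := szD (nform c d) (c ^+ 2); rewrite -hde szM// sq//.
    by lia.
  have N' : nform e c = - nform c d by rewrite /nform /e; ring.
  have [||/=|u u0 [k ek]] := IH e c; first by lia.
  + by rewrite c0 orbT.
  + by rewrite N' szN.
  exists u => //; exists (k - 1); apply: (mulIf al0).
  have -> : pl u%:P * al ^ (k - 1) * al = pl u%:P * al ^ k.
    by rewrite -mulrA -{2}(expr1z al) -expfzDr// subrK.
  rewrite -ek /e.
  transitivity (pl c * al ^+ 2 + pl d * al); first by ring.
  by rewrite al2; ring.
- pose e := c - d * P.
  have hce : c * e = d ^+ 2 - nform c d by rewrite /nform /e; ring.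
  have se : (size e < size c)%N.
    have [->|e0] := eqVneq e 0; first by rewrite size_poly0.
    have := szD (d ^+ 2) (- nform c d).
    by rewrite -hce szM// sq// szN; lia.
  have N' : nform d e = - nform c d by rewrite /nform /e; ring.
  have [||/=|u u0 [k ek]] := IH d e; first by lia.
  + by rewrite d0.
  + by rewrite N' szN.
  exists u => //; exists (k + 1); rewrite expfzDr// expr1z mulrA -ek /e; apply/esym.
  transitivity (pl d * al ^+ 2 + (pl c - pl d * pl P) * al); first by ring.
  by rewrite al2; ring.
(* Equal sizes: [c * d * P] alone has the top degree, so the norm has size at least 2. *)
have s1 : size (c * d * P) = (size c + size d)%N.
  by rewrite !szM ?mulf_neq0// hP; lia.
have s2 : (size (d ^+ 2 - c ^+ 2)%R < size (c * d * P)%R)%N.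
  by apply: leq_ltn_trans (szD _ _) _; rewrite szN !sq// s1; lia.
have eN : nform c d = c * d * P + (d ^+ 2 - c ^+ 2) by rewrite /nform; ring.
by move: hN; rewrite eN size_polyDl// s1 -ecd; case: (size c) sc => // k; rewrite addnS.
Qed.

Lemma polyC_laurent_neq0 (u : F) : u != 0 -> pl u%:P != 0.
Proof. by rewrite poly_laurent_neq0 polyC_eq0. Qed.

Lemma deg_polyC (u : F) : u != 0 -> deg (pl u%:P) = 0.
Proof. by move=> u0; rewrite deg_poly ?polyC_eq0// size_polyC u0. Qed.

(** The other root of X^2 - P X - 1; [gconj_moebius] identifies its images with the Galois
    conjugates. *)
Definition al' := - al^-1.

Lemma al_trace : al + al' = pl P. Proof. by rewrite {1}hal addrK. Qed.
Lemma al_norm : al * al' = -1. Proof. by rewrite mulrN mulfV// al_neq0. Qed.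

Lemma nformE c d : pl (nform c d) = (pl c * al + pl d) * (pl c * al' + pl d).
Proof.
transitivity (pl d ^+ 2 + pl c * pl d * pl P - pl c ^+ 2).
  by rewrite /nform; ring.
rewrite -al_trace; have -> : pl c ^+ 2 = - pl c ^+ 2 * (al * al') by rewrite al_norm mulrN1 opprK.
by ring.
Qed.

(** A zero value has norm zero, so [nform_units] would write it as a nonzero constant times a power
    of [al]. *)
Lemma al_free c d : (c != 0) || (d != 0) -> pl c * al + pl d != 0.
Proof.
move=> cd0; apply/eqP => e.
have N0 : nform c d = 0.
  by apply/eqP; rewrite -poly_laurent_eq0 nformE e mul0r.
have := nform_units cd0; rewrite N0 size_poly0 => /(_ isT)[u u0 [k]].
by rewrite e => /esym/eqP; rewrite mulf_eq0 expfz_eq0 (negbTE al_neq0) andbF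
  orbF (negbTE (polyC_laurent_neq0 u0)).
Qed.

Lemma al'_free c d : (c != 0) || (d != 0) -> pl c * al' + pl d != 0.
Proof.
move=> cd0; rewrite /al'; have al0 := al_neq0.
have := @al_free d (- c); rewrite oppr_eq0 orbC => /(_ cd0).
apply: contra => /eqP e; apply/eqP.
transitivity ((pl c * - al^-1 + pl d) * al); last by rewrite e mul0r.
by field.
Qed.

Lemma nform_neq0 c d : (c != 0) || (d != 0) -> nform c d != 0.
Proof.
move=> cd0; rewrite -poly_laurent_neq0 nformE.
by apply: mulf_neq0; [exact: al_free|exact: al'_free].
Qed.

Lemma deg_al' : deg al' = - 1.
Proof. by rewrite degN degV ?al_neq0// dal. Qed.

Lemma al_sub : al - al' != 0 /\ deg (al - al') = 1.
Proof.
by rewrite -dal; apply: (@deg_lead _ _ _ (- 1)); rewrite ?dal ?al_neq0//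
  dleN// -deg_al' dle_deg.
Qed.

End GoldenUnits.

(** * Numerators and denominators of convergents *)

Section Continuants.
Variables (F : fieldType) (a : nat -> {poly F}).

(** Carries two consecutive terms of the recurrence. In [a k] the index is the matched successor, so
    the first step uses [a 1]. *)
Fixpoint continuants (u v : {poly F}) (k : nat) : {poly F} * {poly F} :=
  if k is k'.+1 then
    let: (s, r) := continuants u v k' in (r, a k * r + s)
  else (u, v).

(* Indices are shifted: [cnum k.+1 / cden k.+1] is the [k]-th convergent. *)
Definition cden k := (continuants 0 1 k).1.
Definition cnum k := (continuants 1 (a 0%N) k).1.

Lemma continuantsS u v k : (continuants u v k.+2).1
  = a k.+1 * (continuants u v k.+1).1 + (continuants u v k).1.
Proof. by rewrite /=; case: (continuants u v k). Qed.

Lemma cden0 : cden 0 = 0. Proof. by []. Qed.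
Lemma cden1 : cden 1 = 1. Proof. by []. Qed.
Lemma cdenS k : cden k.+2 = a k.+1 * cden k.+1 + cden k.
Proof. exact: continuantsS. Qed.
Lemma cnum0 : cnum 0 = 1. Proof. by []. Qed.
Lemma cnum1 : cnum 1 = a 0%N. Proof. by []. Qed.
Lemma cnumS k : cnum k.+2 = a k.+1 * cnum k.+1 + cnum k.
Proof. exact: continuantsS. Qed.

Lemma continuant_det k :
  cnum k.+1 * cden k - cnum k * cden k.+1 = (-1) ^+ k.+1.
Proof.
elim: k => [|k IH]; first by rewrite cden0 cden1 cnum0 mulr0 sub0r mulr1.
by rewrite cnumS cdenS exprS -IH; ring.
Qed.

End Continuants.

(** * Complete quotients, and the degrees of denominators and errors *)

Section CompleteQuotients.
Variables (F : fieldType) (a : nat -> {poly F}) (y : nat -> laurent F).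

Definition complete_quotients :=
  [/\ forall k, y k = pl (a k) + (y k.+1)^-1,
      forall k, y k.+1 != 0 & forall k, 1 <= deg (y k.+1)].

Hypothesis hy : complete_quotients.

Let yE k : y k = pl (a k) + (y k.+1)^-1. Proof. by case: hy. Qed.
Let y0 k : y k.+1 != 0. Proof. by case: hy. Qed.
Let dy k : 1 <= deg (y k.+1). Proof. by case: hy. Qed.

Definition cerr k := pl (cden a k) * y 0%N - pl (cnum a k).
(** The shift avoids [cden a 0], which is 0 and has only a junk degree. *)
Definition cdeg k : int := deg (pl (cden a k.+1)).

Lemma dle_inv k : dle (y k.+1)^-1 (- 1).
Proof. exact: dle_inv_large (dy k). Qed.

Lemma deg_pquot k : a k.+1 != 0 /\ deg (pl (a k.+1)) = deg (y k.+1).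
Proof.
have -> : pl (a k.+1) = y k.+1 - (y k.+2)^-1 by rewrite {1}yE addrK.
rewrite -poly_laurent_neq0.
have -> : pl (a k.+1) = y k.+1 - (y k.+2)^-1 by rewrite {1}yE addrK.
apply: (@deg_lead _ _ _ (- 1)) => //; first by rewrite dleN ?dle_inv.
by move: (dy k); lia.
Qed.

Lemma size_pquot k : (size (a k.+1))%:Z = deg (y k.+1) + 1.
Proof. by have [a0 <-] := deg_pquot k; rewrite deg_poly//; lia. Qed.

Lemma cerrS k : cerr k = - y k.+1 * cerr k.+1.
Proof.
elim: k => [|k IH].
  rewrite /cerr cden0 cden1 cnum0 cnum1 rmorph0 rmorph1 mul0r mul1r sub0r.
  by rewrite (yE 0) addrC addKr mulNr mulfV.
have -> : cerr k.+2 = pl (a k.+1) * cerr k.+1 + cerr k.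
  by rewrite /cerr cdenS cnumS; ring.
have -> : pl (a k.+1) = y k.+1 - (y k.+2)^-1 by rewrite {1}yE addrK.
rewrite IH; have := y0 k.+1; move: (y k.+1) (y k.+2) (cerr k.+1) => u v w v0.
by field.
Qed.

(** The three facts go together: the bound on [cden a k] lets [a k.+1 * cden a k.+1] dominate the
    recurrence, which yields the next bound. It is stated with [dle] because [cden a 0 = 0]. *)
Lemma den_deg k : [/\ cden a k.+1 != 0, dle (pl (cden a k)) (cdeg k - 1) &
  cdeg k.+1 = cdeg k + deg (y k.+1)].
Proof.
have step i : cden a i.+1 != 0 -> dle (pl (cden a i)) (cdeg i - 1) ->
    cden a i.+2 != 0 /\ cdeg i.+1 = cdeg i + deg (y i.+1).
  move=> di hi; have [a0 da] := deg_pquot i.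
  have E : pl (cden a i.+2) = pl (a i.+1) * pl (cden a i.+1) + pl (cden a i).
    by rewrite cdenS; ring.
  have m0 : pl (a i.+1) * pl (cden a i.+1) != 0.
    by rewrite mulf_neq0 ?poly_laurent_neq0.
  have dm : deg (pl (a i.+1) * pl (cden a i.+1)) = deg (y i.+1) + cdeg i.
    by rewrite degM ?poly_laurent_neq0// da.
  have [|n0 dn] := deg_lead m0 hi; first by rewrite dm; move: (dy i); lia.
  by rewrite -poly_laurent_neq0 /cdeg E n0 dn dm addrC.
elim: k => [|k [dk hk ck]].
  have d0 : cden a 1 != 0 by rewrite cden1 oner_eq0.
  have h0 : dle (pl (cden a 0)) (cdeg 0 - 1) by rewrite cden0 raddf0 dle0.
  by have [] := step 0 d0 h0.
have [dk' _] := step k dk hk.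
have hk' : dle (pl (cden a k.+1)) (cdeg k.+1 - 1).
  by apply: dle_trans (dle_deg _) _; rewrite ck -/(cdeg k); move: (dy k); lia.
by have [] := step k.+1 dk' hk'.
Qed.

Lemma cden_neq0 k : cden a k.+1 != 0. Proof. by have [] := den_deg k. Qed.
Lemma pcden_neq0 k : pl (cden a k.+1) != 0.
Proof. by rewrite poly_laurent_neq0 cden_neq0. Qed.
Lemma dle_den k : dle (pl (cden a k)) (cdeg k - 1).
Proof. by have [] := den_deg k. Qed.
Lemma cdegS k : cdeg k.+1 = cdeg k + deg (y k.+1).
Proof. by have [] := den_deg k. Qed.
Lemma cdeg0 : cdeg 0 = 0. Proof. by rewrite /cdeg cden1 rmorph1 deg1. Qed.

Lemma cdeg_ge k : k%:Z <= cdeg k.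
Proof.
by elim: k => [|k IH]; rewrite ?cdeg0// cdegS; move: (dy k); lia.
Qed.

(** From [cerr 0 = -1] on, each step divides the error by [- y k.+1] ([cerrS]) and adds the degree
    of [y k.+1] to that of the denominator ([cdegS]). *)
Lemma cerr_deg k : cerr k != 0 /\ deg (cerr k) = - cdeg k.
Proof.
elim: k => [|k [e0 de]].
  rewrite /cerr cden0 cnum0 rmorph0 rmorph1 mul0r sub0r oppr_eq0 oner_eq0.
  by rewrite degN deg1 cdeg0.
have E : cerr k.+1 = - (cerr k / y k.+1).
  rewrite (cerrS k); have := y0 k; move: (y k.+1) (cerr k.+1) => u v u0.
  by field.
rewrite E oppr_eq0 degN mulf_neq0 ?invr_eq0// deg_div// de cdegS.
by split => //; lia.
Qed.

Lemma cquot_den_deg k : let z := pl (cden a k.+1) * y k.+1 + pl (cden a k) in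
  z != 0 /\ deg z = cdeg k + deg (y k.+1).
Proof.
rewrite /=; have d := degM (pcden_neq0 k) (y0 k).
rewrite -/(cdeg k) in d; rewrite -d; apply: deg_lead (dle_den k) _.
  by rewrite mulf_neq0// pcden_neq0.
by rewrite d; move: (dy k); lia.
Qed.

Lemma cquot_homography k : y 0%N = (pl (cnum a k.+1) * y k.+1 + pl (cnum a k))
  / (pl (cden a k.+1) * y k.+1 + pl (cden a k)).
Proof.
have [z0 _] := cquot_den_deg k; apply: (canRL (mulfK z0)).
have := cerrS k; rewrite /cerr => /eqP; rewrite -subr_eq0 => /eqP e.
by apply/eqP; rewrite -subr_eq0 -e; apply/eqP; ring.
Qed.

(** If [pl d * y 0 = pl n], then [pl d * cerr k] is a nonzero polynomial for every [k], yet by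
    [cerr_deg] its degree is negative for large [k]. *)
Lemma cf_irrational (n d : {poly F}) : d != 0 -> pl d * y 0%N != pl n.
Proof.
move=> d0; apply/eqP => e.
pose k := (size d).+1.
pose m := cden a k * n - cnum a k * d.
have E : pl d * cerr k = pl m.
  rewrite /cerr /m; transitivity (pl (cden a k) * (pl d * y 0%N)
    - pl (cnum a k) * pl d); first by ring.
  by rewrite e; ring.
have [e0 de] := cerr_deg k.
have pd0 : pl d != 0 by rewrite poly_laurent_neq0.
have m0 : m != 0 by rewrite -poly_laurent_neq0 -E mulf_neq0.
have := deg_poly_ge0 m0; rewrite -E degM// de deg_poly//.
by have := cdeg_ge k; rewrite {1}/k; lia.
Qed.

End CompleteQuotients.

(** * Agreement of partial quotients with constant multiples of [P], forwards and backwards *)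

Section Agreement.
Variables (F : fieldType) (P : {poly F}) (al : laurent F).
Hypotheses (hP : size P = 2%N) (hal : al = pl P + al^-1) (dal : deg al = 1).
Variables (a : nat -> {poly F}) (y : nat -> laurent F).
Hypothesis hy : complete_quotients a y.
Hypothesis y_neq : forall k (u : F), u != 0 -> y k.+1 - pl u%:P * al != 0.

(* The logarithms of the two factors of [|x - b| / |b - b'|] at [b = g_k(u al)]:
   see [cf_point_ratio]. *)
Definition fwd (u : F) k : int := deg (y k.+1 - pl u%:P * al) - deg (y k.+1).
Definition bwd (u : F) k : int :=
  deg (pl u%:P * pl (cden a k.+1) - pl (cden a k) * al) - cdeg a k.

Let al0 := al_neq0 hP hal.
Let y0 k : y k.+1 != 0. Proof. by case: hy. Qed.
Let dy k : 1 <= deg (y k.+1). Proof. by case: hy. Qed.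
Let yE k : y k = pl (a k) + (y k.+1)^-1. Proof. by case: hy. Qed.

Let szZ (u : F) : u != 0 -> size (u *: P) = 2%N.
Proof. by move=> u0; rewrite size_scale. Qed.

(** Leading terms can cancel only when [a k.+1] has size 2, and a nonconstant difference then still
    has size 2. *)
Let sz_big (u : F) k : u != 0 -> (1 < size (a k.+1 - u *: P)%R)%N ->
  (size (a k.+1 - u *: P))%:Z = deg (y k.+1) + 1.
Proof.
move=> u0; rewrite -(size_pquot hy k); have := size_pquot hy k; have := dy k.
have := szZ u0; rewrite -(size_polyN (u *: P)) => s2 d1 sa.
have [h|h _] := leqP (size (a k.+1)) 2.
  by have := size_polyD (a k.+1) (- (u *: P)); rewrite s2; lia.
by rewrite size_polyDl// s2.
Qed.

Let sz_const (u : F) k : u != 0 -> (size (a k.+1 - u *: P)%R <= 1)%N ->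
  deg (y k.+1) = 1.
Proof.
move=> u0 h; have := size_pquot hy k.
have -> : size (a k.+1) = 2%N.
  rewrite -(subrK (u *: P) (a k.+1)) addrC size_polyDl szZ//.
by lia.
Qed.

(** The first term is a polynomial and the rest has degree at most -1. The lemmas below treat a
    nonconstant, a nonzero constant and a zero polynomial in turn. *)
Let fwdE (u : F) k : y k.+1 - pl u%:P * al
  = pl (a k.+1 - u *: P) + ((y k.+2)^-1 - pl u%:P * al^-1).
Proof.
by rewrite yE {1}hal -mul_polyC; ring.
Qed.

Let dle_al (u : F) : dle (pl u%:P * al^-1) (- 1).
Proof.
apply: (@dleM _ _ _ 0 (- 1)).
  by apply: dle_trans (dle_poly _) _; have := size_polyC_leq1 u; lia.
by apply: dle_trans (dle_deg _) _; rewrite degV// dal.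
Qed.

Lemma fwd_big (u : F) k : u != 0 -> (1 < size (a k.+1 - u *: P)%R)%N -> fwd u k = 0.
Proof.
move=> u0 h; have E := sz_big u0 h.
have n0 : a k.+1 - u *: P != 0 by rewrite -size_poly_eq0; lia.
rewrite /fwd fwdE; have d := deg_poly n0.
have [|||_ ->] := @deg_lead F (pl (a k.+1 - u *: P))
  ((y k.+2)^-1 - pl u%:P * al^-1) (- 1).
- by rewrite poly_laurent_neq0; exact: n0.
- by apply: dleB (dle_inv hy _) (dle_al _).
- by rewrite d; lia.
by rewrite d E; lia.
Qed.

Lemma fwd_const (u : F) k : u != 0 -> size (a k.+1 - u *: P) = 1%N -> fwd u k = - 1.
Proof.
move=> u0 h; have E := sz_const u0 (eq_leq h).
have n0 : a k.+1 - u *: P != 0 by rewrite -size_poly_eq0 h.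
rewrite /fwd fwdE E; have d := deg_poly n0; rewrite h in d.
have [|||_ ->] := @deg_lead F (pl (a k.+1 - u *: P))
  ((y k.+2)^-1 - pl u%:P * al^-1) (- 1).
- by rewrite poly_laurent_neq0; exact: n0.
- by apply: dleB (dle_inv hy _) (dle_al _).
- by rewrite d.
by rewrite d.
Qed.

(** Once the polynomial part cancels, [1/y - u/al = - u (y - al/u) / (y al)] with [y] at index
    [k.+2]. Hence [u] is inverted, and the degrees 1 of [al] and of [y k.+1] account for the 2. *)
Lemma fwd_eq (u : F) k : u != 0 -> a k.+1 = u *: P -> fwd u k = fwd u^-1 k.+1 - 2.
Proof.
move=> u0 h; have E : deg (y k.+1) = 1.
  by apply: (sz_const u0); rewrite h subrr size_poly0.
rewrite /fwd fwdE E h subrr raddf0 add0r.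
have u'0 : u^-1 != 0 by rewrite invr_eq0.
have uu : pl u%:P * pl u^-1%:P = 1 by rewrite -rmorphM /= -polyCM mulfV// rmorph1.
pose z := y k.+2 - pl u^-1%:P * al.
have z0 : z != 0 by exact: y_neq.
transitivity (deg z - deg (y k.+2) - 2); last by [].
have -> : (y k.+2)^-1 - pl u%:P / al = - (pl u%:P * (z / (y k.+2 * al))).
  rewrite /z; have := y0 k.+1; move: al0 uu.
  move: (y k.+2) al (pl u%:P) (pl u^-1%:P) => v w s t w0 st v0.
  transitivity (- (s * v - (s * t) * w) / (v * w)).
    by rewrite st mul1r; field; rewrite w0 v0.
  by field; rewrite w0 v0.
rewrite degN degM ?deg_polyC ?polyC_laurent_neq0//; last first.
  by rewrite mulf_neq0 ?invr_eq0 ?mulf_neq0.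
by rewrite deg_div ?mulf_neq0// degM// dal; lia.
Qed.

Lemma fwd_le0 (u : F) k : u != 0 -> fwd u k <= 0.
Proof.
move=> u0; rewrite /fwd subr_le0; apply: dle_le; first exact: y_neq.
apply: dleB; first exact: dle_deg.
apply: dle_trans (dle_deg _) _.
by rewrite degM ?polyC_laurent_neq0// deg_polyC// dal; move: (dy k); lia.
Qed.

Lemma bwd_neq0 (u : F) k : u != 0 ->
  pl u%:P * pl (cden a k.+1) - pl (cden a k) * al != 0.
Proof.
move=> u0.
have -> : pl u%:P * pl (cden a k.+1) - pl (cden a k) * al
  = pl (- cden a k) * al + pl (u%:P * cden a k.+1) by ring.
apply: (al_free hP hal dal); apply/orP; right.
by apply: mulf_neq0; [rewrite polyC_eq0|exact: cden_neq0 hy k].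
Qed.

Lemma bwd_le0 (u : F) k : u != 0 -> bwd u k <= 0.
Proof.
move=> u0; rewrite /bwd subr_le0; apply: dle_le; first exact: bwd_neq0.
apply: dleB.
  apply: dle_trans (dle_deg _) _.
  by rewrite degM ?polyC_laurent_neq0 ?(pcden_neq0 hy)// deg_polyC// add0r.
apply: dle_trans (dleM (dle_den hy k) (dle_deg al)) _.
by rewrite dal subrK.
Qed.

(** Base of the backward recursion: [cden a 0 = 0], and [a 0] enters no denominator. *)
Lemma bwd0 (u : F) : u != 0 -> bwd u 0 = 0.
Proof.
move=> u0; rewrite /bwd cden0 cden1 cdeg0 raddf0 mul0r rmorph1 mulr1 !subr0.
exact: deg_polyC.
Qed.

(** The mirror of [fwdE]: the recurrence of the denominators leads back to index [k] with [u]
    inverted, and [bwd_dle] bounds the last product. *)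
Let bwdE (u : F) k : u != 0 ->
  pl u%:P * pl (cden a k.+2) - pl (cden a k.+1) * al =
  pl (a k.+1 - u^-1 *: P) * (pl u%:P * pl (cden a k.+1)) - (pl u%:P / al) *
  (pl u^-1%:P * pl (cden a k.+1) - pl (cden a k) * al).
Proof.
move=> u0; rewrite cdenS -mul_polyC.
have uu : pl u%:P * pl u^-1%:P = 1 by rewrite -rmorphM /= -polyCM mulfV// rmorph1.
transitivity (pl u%:P * (pl (a k.+1) * pl (cden a k.+1) + pl (cden a k))
  - pl (cden a k.+1) * (pl P + al^-1)); first by rewrite -hal; ring.
transitivity ((pl (a k.+1) - pl u^-1%:P * pl P) * (pl u%:P * pl (cden a k.+1))
  - (pl u%:P / al) *
  (pl u^-1%:P * pl (cden a k.+1) - pl (cden a k) * al)); last by ring.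
move: al0 uu; move: al (pl u%:P) (pl u^-1%:P) (pl P) (pl (cden a k.+1)).
move=> w s t p r w0 st; move: (pl (a _)) (pl (cden _ _)) => c d.
transitivity (c * (s * r) - (s * t) * p * r - (s * t) * r / w + s * d).
  by rewrite st !mul1r; field.
by field.
Qed.

Let bwd_dle (u : F) k : u != 0 -> dle ((pl u%:P / al) *
  (pl u^-1%:P * pl (cden a k.+1) - pl (cden a k) * al)) (cdeg a k - 1).
Proof.
move=> u0; have -> : cdeg a k - 1 = -1 + cdeg a k by rewrite addrC.
apply: dleM; first exact: dle_al.
apply: dle_trans (dle_deg _) _.
by rewrite -subr_le0; apply: bwd_le0; rewrite invr_eq0.
Qed.

Lemma bwd_big (u : F) k : u != 0 -> (1 < size (a k.+1 - u^-1 *: P)%R)%N ->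
  bwd u k.+1 = 0.
Proof.
move=> u0 h; have u'0 : u^-1 != 0 by rewrite invr_eq0.
have E := sz_big u'0 h.
have n0 : a k.+1 - u^-1 *: P != 0 by rewrite -size_poly_eq0; lia.
have d := deg_poly n0.
have m0 : pl (a k.+1 - u^-1 *: P) * (pl u%:P * pl (cden a k.+1)) != 0.
  by rewrite !mulf_neq0 ?polyC_laurent_neq0 ?(pcden_neq0 hy) ?poly_laurent_neq0.
have dm : deg (pl (a k.+1 - u^-1 *: P) * (pl u%:P * pl (cden a k.+1)))
    = deg (y k.+1) + cdeg a k.
  rewrite degM ?degM ?mulf_neq0 ?polyC_laurent_neq0 ?(pcden_neq0 hy)//.
    by rewrite deg_polyC// d E -/(cdeg a k); lia.
  by rewrite poly_laurent_neq0.
rewrite /bwd bwdE//.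
have [|_ ->] := deg_lead m0 (dleN (bwd_dle k u0)).
  by rewrite dm; move: (dy k); lia.
by rewrite dm (cdegS hy); lia.
Qed.

Lemma bwd_const (u : F) k : u != 0 -> size (a k.+1 - u^-1 *: P) = 1%N ->
  bwd u k.+1 = - 1.
Proof.
move=> u0 h; have u'0 : u^-1 != 0 by rewrite invr_eq0.
have E := sz_const u'0 (eq_leq h).
have n0 : a k.+1 - u^-1 *: P != 0 by rewrite -size_poly_eq0 h.
have d := deg_poly n0; rewrite h in d.
have m0 : pl (a k.+1 - u^-1 *: P) * (pl u%:P * pl (cden a k.+1)) != 0.
  by rewrite !mulf_neq0 ?polyC_laurent_neq0 ?(pcden_neq0 hy) ?poly_laurent_neq0.
have dm : deg (pl (a k.+1 - u^-1 *: P) * (pl u%:P * pl (cden a k.+1)))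
    = cdeg a k.
  rewrite degM ?degM ?mulf_neq0 ?polyC_laurent_neq0 ?(pcden_neq0 hy)//.
    by rewrite deg_polyC// d -/(cdeg a k); lia.
  by rewrite poly_laurent_neq0.
rewrite /bwd bwdE//.
have [|_ ->] := deg_lead m0 (dleN (bwd_dle k u0)).
  by rewrite dm; lia.
by rewrite dm (cdegS hy) E; lia.
Qed.

Lemma bwd_eq (u : F) k : u != 0 -> a k.+1 = u^-1 *: P ->
  bwd u k.+1 = bwd u^-1 k - 2.
Proof.
move=> u0 h; have u'0 : u^-1 != 0 by rewrite invr_eq0.
have E : deg (y k.+1) = 1.
  by apply: (sz_const u'0); rewrite h subrr size_poly0.
rewrite /bwd bwdE// h subrr raddf0 mul0r sub0r degN.
pose z := pl u^-1%:P * pl (cden a k.+1) - pl (cden a k) * al.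
have z0 : z != 0 by exact: bwd_neq0.
transitivity (deg z - cdeg a k - 2); last by [].
rewrite (degM _ z0) ?mulf_neq0 ?invr_eq0 ?polyC_laurent_neq0//.
by rewrite deg_div ?polyC_laurent_neq0// deg_polyC// dal (cdegS hy) E; lia.
Qed.

End Agreement.

(** * Continued fraction expansions of irrational series *)

Definition irrational_series (F : fieldType) (x : laurent F) :=
  forall n d : {poly F}, d != 0 -> pl d * x != pl n.

(** Iterates the inverse of the remainder modulo the floor. Irrationality passes to each inverse
    remainder, so no remainder vanishes. *)
Lemma complete_quotients_exist (F : fieldType) (x : laurent F) :
  irrational_series x -> exists a y, y 0%N = x /\ complete_quotients a y.
Proof.
move=> hx; pose fl z := projT1 (cid (@laurent_floor F z)).
have hfl z : dle (z - pl (fl z)) (- 1) by exact: (projT2 (cid (laurent_floor z))).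
pose y k := iter k (fun z => (z - pl (fl z))^-1) x.
have yS k : y k.+1 = (y k - pl (fl (y k)))^-1 by [].
have nz z : irrational_series z -> z - pl (fl z) != 0.
  by move=> /(_ (fl z) 1 (oner_neq0 _)); rewrite rmorph1 mul1r subr_eq0.
have irr k : irrational_series (y k).
  elim: k => // k IH n d d0; rewrite yS; apply/negP => /eqP e.
  have w0 := nz _ IH; have e' := canRL (mulfVK w0) e.
  have n0 : n != 0.
    apply: contra d0 => /eqP n0; rewrite -poly_laurent_eq0 e' n0.
    by rewrite raddf0 mul0r.
  have /eqP := IH (d + n * fl (y k)) n n0; apply.
  by transitivity (pl d + pl n * pl (fl (y k))); [rewrite e'|]; ring.
exists (fun k => fl (y k)), y; split=> //; split=> k.
- by rewrite yS invrK addrC subrK.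
- by rewrite yS invr_eq0 nz.
rewrite yS degV ?nz//; have := dle_le (nz _ (irr k)) (hfl _); lia.
Qed.

(** * Convergence of continued fractions with nonconstant partial quotients *)

Lemma deg_cf_step (F : fieldType) (p : {poly F}) (x : laurent F) :
  (1 < size p)%N -> dle x (- 1) -> pl p + x != 0 /\ 1 <= deg (pl p + x).
Proof.
move=> sp hx; have p0 : p != 0 by rewrite -size_poly_eq0; case: size sp.
have dp := deg_poly p0.
have [||n0 ->] := @deg_lead F (pl p) x (- 1) _ hx.
- by rewrite poly_laurent_neq0.
- by rewrite dp; lia.
by split => //; rewrite dp; lia.
Qed.

(** The denominator [x x'] of the difference has degree at least 2; this gain at each level is the
    rate of convergence. *)
Lemma dle_sub_inv (F : fieldType) (x x' : laurent F) (m : int) : x != 0 -> x' != 0 ->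
  1 <= deg x -> 1 <= deg x' -> dle (x - x') m -> dle (x^-1 - x'^-1) (m - 2).
Proof.
move=> x0 x'0 dx dx' h.
have -> : x^-1 - x'^-1 = - (x - x') * (x^-1 * x'^-1).
  by field; rewrite x0 x'0.
have -> : m - 2 = m + (- 1 + - 1) by lia.
by rewrite dleM ?dleN// dleM ?dle_inv_large.
Qed.

Lemma dle_coef (F : fieldType) (x y : laurent F) n i : dle (x - y) n -> i < - n -> x i = y i.
Proof.
by move=> /dleP h /h; rewrite lcoefB => /eqP; rewrite subr_eq0 => /eqP.
Qed.

Section ContinuedFractionLimit.
Variable F : finFieldType.
Implicit Type a : nat -> {poly F}.

Let shift a k := a k.+1.

Lemma convergent_deg a n : (forall k, (1 < size (a k))%N) ->
  convergent a n != 0 /\ 1 <= deg (convergent a n).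
Proof.
elim: n a => [|n IH] a ha /=.
  by rewrite -[pl _]addr0; apply: deg_cf_step; rewrite ?dle0.
apply: deg_cf_step => //; apply: dle_inv_large.
by have [] := IH (shift a) (fun k => ha k.+1).
Qed.

Lemma convergent_step a n : (forall k, (1 < size (a k))%N) ->
  dle (convergent a n.+1 - convergent a n) (- 1 - 2 * n%:Z).
Proof.
elim: n a => [|n IH] a ha.
  rewrite /= addrC addKr; apply: dle_inv_large.
  by have [] := convergent_deg 0 (fun k => ha k.+1).
have hs k : (1 < size (shift a k))%N by exact: ha.
have [c0 dc] := convergent_deg n hs; have [c'0 dc'] := convergent_deg n.+1 hs.
have -> : convergent a n.+2 - convergent a n.+1
    = (convergent (shift a) n.+1)^-1 - (convergent (shift a) n)^-1.
  by rewrite [LHS]/= opprD addrACA subrr add0r.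
have -> : - 1 - 2 * n.+1%:Z = - 1 - 2 * n%:Z - 2 by lia.
exact: dle_sub_inv (IH _ hs).
Qed.

Lemma convergent_agree a n m : (forall k, (1 < size (a k))%N) -> (n <= m)%N ->
  dle (convergent a m - convergent a n) (- 1 - 2 * n%:Z).
Proof.
move=> ha; elim: m => [|m IH]; first by rewrite leqn0 => /eqP ->; rewrite subrr dle0.
rewrite leq_eqVlt => /predU1P[->|nm]; first by rewrite subrr dle0.
rewrite -(subrK (convergent a m) (convergent a m.+1)) -addrA dleD ?IH//.
by apply: dle_trans (convergent_step m ha) _; lia.
Qed.

Lemma cfrac_limit a : (forall k, (1 < size (a k))%N) -> exists x : laurent F,
  forall n, dle (x - convergent a n) (- 1 - 2 * n%:Z).
Proof.
(* The coefficient of index i is stable from the convergent number |i| on, because i < 1 + 2|i|. *)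
move=> ha; pose f (i : int) := convergent a `|i| i.
have fE n i : i < 1 + 2 * n%:Z -> f i = convergent a n i.
  move=> hi; rewrite /f; have [h|h] := leqP n `|i|.
    by apply: (dle_coef (convergent_agree ha h)); lia.
  by apply/esym; apply: (dle_coef (convergent_agree ha (ltnW h))); lia.
have fP : is_laurent f.
  apply/asboolP; exists (Num.min 0 (- deg (convergent a 0))) => i hi.
  rewrite (fE 0%N); last by lia.
  by apply: (dleP _ _ (dle_deg _)); lia.
exists (Laurent fP) => n; apply/dleP => i hi.
by apply/eqP; rewrite lcoefB subr_eq0; apply/eqP/fE; lia.
Qed.

(** Identifies the value chosen by [xget]: the coefficientwise limit is a limit for the topology,
    and two limits agree at every coefficient. *)
Lemma cfracP a : (forall k, (1 < size (a k))%N) ->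
  forall n, dle (cfrac a - convergent a n) (- 1 - 2 * n%:Z).
Proof.
move=> ha; have [x hx] := cfrac_limit ha.
suff -> : cfrac a = x by [].
apply: xget_subset1 => /=.
  move=> A [n _ nA]; exists `|n|%N => // m /= nm; apply: nA => /= i hi.
  by apply/esym; apply: (dle_coef (hx m)); lia.
move=> u v /= hu hv; apply: lcoef_inj => i.
have nb (w : laurent F) : nbhs w [set z : laurent F | z i = w i].
  by exists (i + 1) => // z /= h; apply: h; lia.
have [n1 _ h1] := hu _ (nb u); have [n2 _ h2] := hv _ (nb v).
have := h1 (maxn n1 n2) (leq_maxl _ _); have := h2 (maxn n1 n2) (leq_maxr _ _).
by move=> /= -> ->.
Qed.

Lemma cfrac_deg a : (forall k, (1 < size (a k))%N) ->
  cfrac a != 0 /\ 1 <= deg (cfrac a).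
Proof.
move=> ha; rewrite -(subrK (pl (a 0%N)) (cfrac a)) addrC.
by apply: deg_cf_step => //; exact: (cfracP ha 0).
Qed.

Lemma cfracS a : (forall k, (1 < size (a k))%N) ->
  cfrac a = pl (a 0%N) + (cfrac (shift a))^-1.
Proof.
move=> ha; have hs k : (1 < size (shift a k))%N by exact: ha.
apply/eqP; rewrite -subr_eq0; apply/eqP; apply: dle_all => n.
have [c0 dc] := convergent_deg n hs; have [s0 ds] := cfrac_deg hs.
have -> : cfrac a - (pl (a 0%N) + (cfrac (shift a))^-1)
  = (cfrac a - convergent a n.+1)
    - ((cfrac (shift a))^-1 - (convergent (shift a) n)^-1).
  have -> : convergent a n.+1 = pl (a 0%N) + (convergent (shift a) n)^-1 by [].
  by ring.
apply: dleB; first by apply: dle_trans (cfracP ha n.+1) _; lia.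
by apply: dle_trans (dle_sub_inv s0 c0 ds dc (cfracP hs n)) _; lia.
Qed.

Lemma cfrac_complete_quotients a : (forall k, (1 < size (a k))%N) ->
  complete_quotients a (fun k => cfrac (fun i => a (i + k)%N)).
Proof.
move=> ha; have hs k i : (1 < size (a (i + k)%N))%N by exact: ha.
split=> k; last 2 first.
- by have [] := cfrac_deg (hs k.+1).
- by have [] := cfrac_deg (hs k.+1).
rewrite cfracS//; congr (_ + (cfrac _)^-1).
by apply/funext => i; rewrite /shift addnS.
Qed.

End ContinuedFractionLimit.

(** * Galois conjugates characterized by trace and norm *)

Section GaloisConjugate.
Variable F : finFieldType.
Implicit Types x b : laurent F.

Lemma range_fracP x : range (@frac_laurent F) x <-> ~ irrational_series x.
Proof.
split.
  case=> k _ <- /(_ (repr k).1 (repr k).2 (denom_ratioP (repr k))) /eqP; apply.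
  have d0 : pl (repr k).2 != 0 by rewrite poly_laurent_neq0; exact: denom_ratioP.
  by rewrite /frac_laurent mulrC divfK.
move=> h; apply: contrapT => nr; apply: h => n d d0; apply/eqP => e; apply: nr.
exists (tofrac n / tofrac d) => //; rewrite frac_laurentE//.
by apply/esym/(canRL (mulfK _)); rewrite ?poly_laurent_neq0// mulrC.
Qed.

Lemma galois_conjugatesP x b : galois_conjugates x b ->
  range (@frac_laurent F) (x + b) /\ range (@frac_laurent F) (x * b).
Proof.
case=> p [_ _ e].
have {}e : map_poly (@frac_laurent F) p
    = 'X^2 - (x + b) *: 'X + (x * b)%:P.
  by rewrite e -mul_polyC; ring.
split.
  exists (- p`_1) => //; rewrite raddfN /= -coef_map e.
  by rewrite !coefE /= mulr1 addr0 sub0r opprK.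
exists (p`_0) => //; rewrite -coef_map e.
by rewrite !coefE /= mulr0 subr0 add0r.
Qed.

(** Existence: the roots [x] and [b = s - x] of X^2 - s X + t are not in F(Y), so this polynomial is
    irreducible. Uniqueness: for two conjugates, [b1 - b2] and [x * (b1 - b2)] lie in F(Y), and if
    [b1 != b2] so does [x]. *)
Lemma gconjP x b : irrational_series x -> range (@frac_laurent F) (x + b) ->
  range (@frac_laurent F) (x * b) -> gconj x = b.
Proof.
move=> hx [s _ es] [t _ et]; apply: xget_subset1 => /=; last first.
  have aux b1 b2 : galois_conjugates x b1 -> galois_conjugates x b2 -> b1 = b2.
    move=> /galois_conjugatesP[[s1 _ e1] [t1 _ f1]].
    move=> /galois_conjugatesP[[s2 _ e2] [t2 _ f2]].
    apply: contrapT => ne.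
    have b12 : b1 - b2 != 0 by rewrite subr_eq0; apply/eqP.
    have e : frac_laurent (s1 - s2) = b1 - b2.
      by rewrite raddfB /= e1 e2; ring.
    have f : frac_laurent (t1 - t2) = x * (b1 - b2).
      by rewrite raddfB /= f1 f2; ring.
    suff : ~ irrational_series x by [].
    apply/range_fracP; exists ((t1 - t2) / (s1 - s2)) => //.
    by rewrite fmorph_div /= e f mulfK.
  exact: aux.
have hn k : frac_laurent k <> x.
  by move=> e; have /range_fracP : range (@frac_laurent F) x by exists k.
pose p : {poly {fraction {poly F}}} := 'X^2 - s *: 'X + t%:P.
have ep : map_poly (@frac_laurent F) p = ('X - x%:P) * ('X - b%:P).
  rewrite /p rmorphD rmorphB /= map_polyXn map_polyZ map_polyX map_polyC /=.
  by rewrite es et -mul_polyC; ring.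
have sp : size p = 3%N.
  have := congr1 (fun q : {poly laurent F} => size q) ep.
  rewrite size_map_poly => ->.
  by rewrite size_Mmonic ?polyXsubC_eq0 ?monicXsubC// !size_XsubC.
exists p; split => //; apply: cubic_irreducible; first by rewrite sp.
move=> k; apply/negP => /rootP pk.
have : (map_poly (@frac_laurent F) p).[frac_laurent k] = 0.
  by rewrite horner_map /= pk raddf0.
rewrite ep hornerM !hornerXsubC => /eqP; rewrite mulf_eq0 !subr_eq0.
move=> /orP[/eqP/hn//|/eqP e]; apply: (hn (s - k)).
by rewrite raddfB /= es e addrK.
Qed.

End GaloisConjugate.

(** * Homographic images of [al]: irrationality, trace, norm, distance to the conjugate *)

Definition moebius (F : fieldType) (a b c d : {poly F}) (t : laurent F) :=
  (pl a * t + pl b) / (pl c * t + pl d).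

Section Orbit.
Variables (F : fieldType) (P : {poly F}) (al : laurent F).
Hypotheses (hP : size P = 2%N) (hal : al = pl P + al^-1) (dal : deg al = 1).
Variables (a b c d : {poly F}) (u : F).
Hypotheses (u0 : u != 0) (det : a * d - b * c = u%:P).

Let al0 := al_neq0 hP hal.

Lemma cd_neq0 : (c != 0) || (d != 0).
Proof.
rewrite -negb_and; apply/negP => /andP[/eqP c0 /eqP d0].
by move: det; rewrite c0 d0 !mulr0 subrr => /esym/eqP; rewrite polyC_eq0 (negbTE u0).
Qed.

Let w0 : pl c * al + pl d != 0. Proof. exact: al_free hP hal dal _ _ cd_neq0. Qed.
Let w'0 : pl c * al' al + pl d != 0.
Proof. exact: al'_free hP hal dal _ _ cd_neq0. Qed.

(** A rational value gives a relation [p al + q = 0], so [p = q = 0] by [al_free]; inverting the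
    matrix, whose determinant is nonzero, forces [m = 0]. *)
Lemma moebius_irrational : irrational_series (moebius a b c d al).
Proof.
move=> n m m0; apply/negP => /eqP e.
have {}e : pl m * (pl a * al + pl b) = pl n * (pl c * al + pl d).
  by rewrite -e /moebius; field.
pose p := m * a - n * c; pose q := m * b - n * d.
have e0 : pl p * al + pl q = 0.
  transitivity (pl m * (pl a * al + pl b) - pl n * (pl c * al + pl d)).
    by rewrite /p /q; ring.
  by rewrite e subrr.
have [pq|] := boolP ((p != 0) || (q != 0)).
  by have := al_free hP hal dal pq; rewrite e0 eqxx.
rewrite negb_or !negbK => /andP[/eqP p0 /eqP q0].
have : m * u%:P = p * d - q * c by rewrite -det /p /q; ring.
rewrite p0 q0 !mul0r subrr => /eqP.
by rewrite mulf_eq0 polyC_eq0 (negbTE u0) orbF (negbTE m0).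
Qed.

Lemma moebius_trace : (moebius a b c d al + moebius a b c d (al' al))
  * pl (nform P c d) = pl (- (a * c) *+ 2 + (a * d + b * c) * P + (b * d) *+ 2).
Proof.
transitivity ((pl a * al + pl b) * (pl c * al' al + pl d)
  + (pl a * al' al + pl b) * (pl c * al + pl d)).
  rewrite (nformE hP hal) /moebius; move: w0 w'0.
  move: (pl a * al + _) (pl c * al + _) (pl a * al' al + _) (pl c * al' al + _).
  by move=> x y x' y' y0 y'0; field; rewrite y0 y'0.
transitivity (pl a * pl c * (al * al' al) *+ 2
  + (pl a * pl d + pl b * pl c) * (al + al' al) + (pl b * pl d) *+ 2).
  by ring.
by rewrite (al_norm hP hal) (al_trace hal); ring.
Qed.

Lemma moebius_norm : (moebius a b c d al * moebius a b c d (al' al))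
  * pl (nform P c d) = pl (nform P a b).
Proof.
rewrite !(nformE hP hal) /moebius; move: w0 w'0.
move: (pl a * al + _) (pl c * al + _) (pl a * al' al + _) (pl c * al' al + _).
by move=> x y x' y' y0 y'0; field; rewrite y0 y'0.
Qed.

(** The difference is [u (al - al')] divided by [nform P c d], so the distance to the conjugate is
    governed by this norm. *)
Lemma moebius_sub : [/\ moebius a b c d al - moebius a b c d (al' al) != 0,
   nform P c d != 0 &
  deg (moebius a b c d al - moebius a b c d (al' al))
    = 1 - deg (pl (nform P c d))].
Proof.
have [s0 ds] := al_sub hP hal dal; have n0 := nform_neq0 hP hal dal cd_neq0.
have pn0 : pl (nform P c d) != 0 by rewrite poly_laurent_neq0.
have -> : moebius a b c d al - moebius a b c d (al' al)
    = pl u%:P * (al - al' al) / pl (nform P c d).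
  rewrite (nformE hP hal) -det /moebius.
  move: w0 w'0; move: (al' al) => t y0 y'0.
  by field; rewrite y0 y'0.
have U0 := polyC_laurent_neq0 u0.
have UA : pl u%:P * (al - al' al) != 0 by rewrite mulf_neq0.
split=> //; first by rewrite mulf_neq0 ?invr_eq0.
by rewrite (deg_div UA pn0) degM// deg_polyC// ds add0r.
Qed.

End Orbit.

(** * Orbit points close to a series come from its convergents *)

Lemma deg_sub_or (F : fieldType) (x y : laurent F) (m n : int) :
  x - y != 0 -> dle x m -> dle y n -> deg (x - y) <= m \/ deg (x - y) <= n.
Proof.
move=> n0 hx hy; have [mn|nm] := leP m n; [right|left]; apply: dle_le => //.
  by apply: dleB => //; exact: dle_trans hx mn.
by apply: dleB => //; apply: dle_trans hy (ltW nm).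
Qed.

(** Here [m] and [de] are the degrees of [y 0 - be] and [be - be']; [c0], [c1], [c2] those of three
    consecutive denominators; the [l] variables those of the linear factors of the form at two
    consecutive convergents. Integrality bounds each product from below and approximation bounds
    each factor from above. The gap of 3 leaves only constant values, with [l1] and [l2] one degree
    apart. *)
Lemma reduced_degrees (de m c0 c1 c2 l1 l1' l2 l2' : int) :
  m - de <= - 3 -> 0 < 2 * c1 + de -> 2 * c0 + de <= 0 -> c0 < c1 -> c1 < c2 ->
  0 <= 1 - de + (l1 + l1') -> 0 <= 1 - de + (l2 + l2') ->
  l1 <= - c1 \/ l1 <= c0 + m -> l1' <= - c1 \/ l1' <= c0 + de ->
  l2 <= - c2 \/ l2 <= c1 + m -> l2' <= - c2 \/ l2' <= c1 + de ->
  [/\ l1 = - c1, l2 = - c1 - 1,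
     1 - de + (l1 + l1') <= 0 & 1 - de + (l2 + l2') <= 0].
Proof. by move=> *; split; lia. Qed.

Section Approximation.
Variables (F : fieldType) (P : {poly F}) (al : laurent F).
Hypotheses (hP : size P = 2%N) (hal : al = pl P + al^-1) (dal : deg al = 1).
Variables (q : nat -> {poly F}) (y : nat -> laurent F).
Hypothesis hy : complete_quotients q y.

Let al0 := al_neq0 hP hal.
Let y0 k : y k.+1 != 0. Proof. by case: hy. Qed.
Let dy k : 1 <= deg (y k.+1). Proof. by case: hy. Qed.

(* The point whose complete quotient of index [k.+1], along the expansion of
   [y 0], is [u t]. *)
Definition cf_point (u : F) k t :=
  moebius (cnum q k.+1 * u%:P) (cnum q k) (cden q k.+1 * u%:P) (cden q k) t.

Lemma cf_point_det (u : F) k : cnum q k.+1 * u%:P * cden q k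
  - cnum q k * (cden q k.+1 * u%:P) = ((-1) ^+ k.+1 * u)%:P.
Proof.
rewrite polyCM rmorphXn rmorphN1 -(continuant_det q) /=; ring.
Qed.

Lemma cf_point_det_neq0 (u : F) k : u != 0 -> (-1) ^+ k.+1 * u != 0.
Proof. by move=> u0; rewrite mulf_neq0 ?expf_neq0 ?oppr_eq0 ?oner_neq0. Qed.

Lemma cf_point_den_deg (u : F) k : u != 0 ->
  let z := pl (cden q k.+1 * u%:P) * al + pl (cden q k) in
  z != 0 /\ deg z = cdeg q k + 1.
Proof.
move=> u0 /=; rewrite rmorphM /=.
have U0 := polyC_laurent_neq0 u0; have r0 := pcden_neq0 hy k.
have d : deg (pl (cden q k.+1) * pl u%:P * al) = cdeg q k + 1.
  by rewrite !degM ?mulf_neq0// deg_polyC// dal addr0.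
rewrite -d; apply: deg_lead (dle_den hy k) _; last by rewrite d; lia.
by rewrite !mulf_neq0.
Qed.

Lemma cf_point_den_deg' (u : F) k : u != 0 ->
  let z := pl (cden q k.+1 * u%:P) * al' al + pl (cden q k) in
  z != 0 /\ deg z = bwd al q u k + cdeg q k - 1.
Proof.
move=> u0 /=; pose w := pl u%:P * pl (cden q k.+1) - pl (cden q k) * al.
have w0 : w != 0 by exact: (bwd_neq0 hP hal dal hy).
have -> : pl (cden q k.+1 * u%:P) * al' al + pl (cden q k) = - (w / al).
  by rewrite /w /al' rmorphM /=; field.
rewrite oppr_eq0 degN mulf_neq0 ?invr_eq0// deg_div// dal /bwd -/w.
by split=> //; rewrite subrK.
Qed.

Lemma cf_point_deg (u : F) k : u != 0 ->
  deg (cf_point u k al - cf_point u k (al' al)) = 1 - 2 * cdeg q k - bwd al q u k.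
Proof.
move=> u0.
have [_ _ ->] := moebius_sub hP hal dal (cf_point_det_neq0 k u0) (cf_point_det u k).
rewrite (nformE hP hal).
have [z0 dz] := cf_point_den_deg k u0; have [z'0 dz'] := cf_point_den_deg' k u0.
by rewrite degM// dz dz'; lia.
Qed.

Lemma cf_point_ratio (u : F) k : u != 0 -> y k.+1 - pl u%:P * al != 0 ->
  y 0%N - cf_point u k al != 0 /\
  deg (y 0%N - cf_point u k al) - deg (cf_point u k al - cf_point u k (al' al))
  = fwd al y u k + bwd al q u k - 2.
Proof.
move=> u0 yu0; rewrite cf_point_deg//.
have [z0 dz] := cf_point_den_deg k u0; have [v0 dv] := cquot_den_deg hy k.
pose sg : F := (-1) ^+ k.+1.
have sg0 : sg != 0 by rewrite expf_neq0// oppr_eq0 oner_neq0.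
have s0 := polyC_laurent_neq0 sg0; have ds := deg_polyC sg0.
have E : y 0%N - cf_point u k al = pl sg%:P * (y k.+1 - pl u%:P * al)
  / ((pl (cden q k.+1) * y k.+1 + pl (cden q k)) *
     (pl (cden q k.+1 * u%:P) * al + pl (cden q k))).
  rewrite /sg rmorphXn rmorphN1 -(continuant_det q).
  rewrite (cquot_homography hy k) /cf_point /moebius; move: z0 v0.
  rewrite !rmorphM !rmorphB !rmorphM /=.
  by move=> z0 v0; field; rewrite z0 v0.
have n0 : pl sg%:P * (y k.+1 - pl u%:P * al) != 0 by rewrite mulf_neq0.
have d0 : (pl (cden q k.+1) * y k.+1 + pl (cden q k)) *
     (pl (cden q k.+1 * u%:P) * al + pl (cden q k)) != 0 by rewrite mulf_neq0.
rewrite E; split; first by rewrite mulf_neq0// invr_eq0.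
by rewrite (deg_div n0 d0) (degM s0 yu0) (degM v0 z0) ds dv dz /fwd; lia.
Qed.

Definition clin k t := pl (cden q k) * t - pl (cnum q k).

Section Form.
Variables (a b c d : {poly F}) (v : F).
Hypotheses (v0 : v != 0) (det : a * d - b * c = v%:P).

Let be := moebius a b c d al.
Let be' := moebius a b c d (al' al).
Let w := pl c * al + pl d.

Let w0 : w != 0. Proof. exact: (al_free hP hal dal (cd_neq0 v0 det)). Qed.

Let w'0 : pl c * al' al + pl d != 0.
Proof. exact: (al'_free hP hal dal (cd_neq0 v0 det)). Qed.

(* [nform C D] is the value at the [k]-th convergent of the integral quadratic
   form with roots [be] and [be'] and leading coefficient [nform c d]. *)
Lemma form_at_convergent k : exists C D : {poly F},
  let l := clin k.+1 be in let l' := clin k.+1 be' in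
  let s := 1 - deg (be - be') + (deg l + deg l') in
  [/\ l != 0 /\ l' != 0, l * w = pl C * al + pl D,
      (C != 0) || (D != 0), 0 <= s & s <= 0 -> (size (nform P C D) <= 1)%N].
Proof.
have [bb0 N0 dbb] := moebius_sub hP hal dal v0 det.
have irr := moebius_irrational hP hal dal v0 det.
pose l := clin k.+1 be; pose l' := clin k.+1 be'.
pose C := cden q k.+1 * a - cnum q k.+1 * c.
pose D := cden q k.+1 * b - cnum q k.+1 * d.
have lC : l * w = pl C * al + pl D.
  transitivity (pl (cden q k.+1) * (be * w) - pl (cnum q k.+1) * w).
    by rewrite /l /clin; ring.
  by rewrite /be /moebius divfK// /w /C /D; ring.
have lC' : l' * (pl c * al' al + pl d) = pl C * al' al + pl D.
  transitivity (pl (cden q k.+1) * (be' * (pl c * al' al + pl d))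
    - pl (cnum q k.+1) * (pl c * al' al + pl d)).
    by rewrite /l' /clin; ring.
  by rewrite /be' /moebius divfK// /C /D; ring.
have l0 : l != 0 by rewrite subr_eq0 irr// (cden_neq0 hy).
have CD0 : (C != 0) || (D != 0).
  rewrite -negb_and; apply/negP => /andP[/eqP C0 /eqP D0].
  move: lC; rewrite C0 D0 raddf0 mul0r addr0 => /eqP.
  by rewrite mulf_eq0 (negbTE w0) (negbTE l0).
have NE : pl (nform P C D) = pl (nform P c d) * (l * l').
  by rewrite !(nformE hP hal) -lC -lC' /w; ring.
have NC0 := nform_neq0 hP hal dal CD0.
have pN0 : pl (nform P c d) != 0 by rewrite poly_laurent_neq0.
have l'0 : l' != 0.
  by have := NC0; rewrite -poly_laurent_neq0 NE !mulf_eq0 !negb_or => /and3P[].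
have ll0 : l * l' != 0 by rewrite mulf_neq0.
have dNE : deg (pl (nform P C D)) = 1 - deg (be - be') + (deg l + deg l').
  by rewrite NE (degM pN0 ll0) (degM l0 l'0) dbb subKr.
exists C, D; split=> //; first by rewrite -dNE deg_poly_ge0.
rewrite -/l -/l' -dNE deg_poly//; clear; lia.
Qed.

Lemma clinE k t : clin k t = cerr q y k - pl (cden q k) * (y 0%N - t).
Proof. by rewrite /clin /cerr; ring. Qed.

Lemma clin_le k t m : dle (y 0%N - t) m -> clin k.+1 t != 0 ->
  deg (clin k.+1 t) <= - cdeg q k.+1 \/ deg (clin k.+1 t) <= cdeg q k + m.
Proof.
rewrite clinE => h l0; apply: deg_sub_or => //.
  by have [_ <-] := cerr_deg hy k.+1; exact: dle_deg.
by rewrite dleM ?dle_deg.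
Qed.

(* The first [k] with [|r_{k+1}|^2 |be - be'| > 1] works: integrality of the
   form at the previous convergent gives [|r_{k+1}|^2 |y 0 - be| < 1], and then
   its values at the convergents [k] and [k.+1] are units. *)
Lemma close_is_approx : y 0%N - be != 0 -> deg (be - be') <= 0 ->
  deg (y 0%N - be) - deg (be - be') <= - 3 ->
  exists2 u : F, u != 0 & exists k, be = cf_point u k al.
Proof.
have aux1 (s t : int) : s - t <= - 3 -> s <= t by clear; lia.
have aux2 (s t : int) : `|t|.+1%:Z <= s -> 0 < 2 * s + t by clear; lia.
move=> xb0 dd0 ratio.
pose de := deg (be - be'); pose m := deg (y 0%N - be).
have dxb' : dle (y 0%N - be') de.
  rewrite -(subrK be (y 0%N)) -addrA dleD ?dle_deg//.
  by apply: dle_trans (dle_deg _) _; exact: aux1.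
have ex : exists k, 0 < 2 * cdeg q k + de.
  by exists `|de|.+1; apply: aux2; exact: cdeg_ge hy `|de|.+1.
case: (ex_minnP ex) => -[|j].
  (* The minimal index is not 0, since [cdeg 0 = 0] and [be - be'] has degree at most 0; so a
     previous index [j] exists. *)
  by rewrite cdeg0 mulr0 add0r ltNge -/de in dd0 *; rewrite dd0.
move=> hj /(_ j) minj.
have {}minj : 2 * cdeg q j + de <= 0.
  by rewrite leNgt; apply/negP => /minj; rewrite ltnn.
have [C1 [D1]] := form_at_convergent j.
have [C2 [D2]] := form_at_convergent j.+1.
cbv zeta; move=> [[l20 l2'0] e2 CD2 h2 s2] [[l10 l1'0] e1 CD1 h1 s1].
have cS k : cdeg q k < cdeg q k.+1.
  by rewrite (cdegS hy) ltrDl; apply: lt_le_trans (dy k).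
have [d1 d2 {}/s1 s1 {}/s2 s2] := reduced_degrees ratio hj minj (cS j) (cS j.+1)
  h1 h2 (clin_le (dle_deg _) l10) (clin_le dxb' l1'0)
  (clin_le (dle_deg _) l20) (clin_le dxb' l2'0).
have [u1 u10 [i1 E1]] := nform_units hP hal dal CD1 s1.
have [u2 u20 [i2 E2]] := nform_units hP hal dal CD2 s2.
rewrite -e1 in E1; rewrite -e2 in E2.
have deg_eq i (z : F) l : l != 0 -> z != 0 -> l * w = pl z%:P * al ^ i ->
    deg l + deg w = i.
  move=> l0 z0 e; have Z0 := polyC_laurent_neq0 z0.
  have A0 : al ^ i != 0 by rewrite expfz_neq0.
  by rewrite -(degM l0 w0) e (degM Z0 A0) deg_polyC// degX// dal mulr1 add0r.
(* The linear factors are one degree apart and [al] has degree 1, so the exponents of the two units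
   differ by one. *)
have i12 : i1 = 1 + i2.
  have := deg_eq _ _ _ l10 u10 E1; have := deg_eq _ _ _ l20 u20 E2.
  by rewrite d1 d2; move: (deg w) (cdeg _ _); clear; lia.
have e : pl u2%:P * clin j.+1 be = pl u1%:P * al * clin j.+2 be.
  apply: (mulIf w0); rewrite -!mulrA E1 E2 i12 expfzDr// expr1z.
  by ring.
have U1 := polyC_laurent_neq0 u10; have U2 := polyC_laurent_neq0 u20.
(* Solving [u2 (clin j.+1 be) = u1 al (clin j.+2 be)] for [be] gives the homographic image of [u al]
   with this [u]. *)
pose u := - (u1 / u2).
have u0 : u != 0 by rewrite oppr_eq0 mulf_neq0 ?invr_eq0.
have Uu : pl u%:P * pl u2%:P = - pl u1%:P.
  by rewrite -rmorphM /= -polyCM mulNr divfK// polyCN raddfN.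
exists u => //; exists j.+1.
have [z0 _] := cf_point_den_deg j.+1 u0.
apply/(canRL (mulfK z0))/eqP; rewrite -subr_eq0.
rewrite -(mulrI_eq0 _ (mulfI U2)); apply/eqP.
transitivity (pl u2%:P * clin j.+1 be
  + (pl u%:P * pl u2%:P) * al * clin j.+2 be).
  by rewrite /clin; ring.
by rewrite Uu e; ring.
Qed.

(* The value of the form of [be] at the convergents has degree
   [1 - deg (y k.+1)] eventually. *)
Lemma in_orbit_deg : y 0%N = be -> exists K, forall k, (K <= k)%N ->
  deg (y k.+1) <= 1.
Proof.
have aux (s t z : int) : 0 <= 1 - z + (- (s + t) + (s + z)) -> t <= 1.
  by clear; lia.
have aux' (k : nat) (s t z : int) : (`|z|.+1 <= k)%N -> k%:Z <= s -> 1 <= t ->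
  - (s + t) < s + z by clear; lia.
move=> xb; pose de := deg (be - be'); exists `|de|.+1 => k hk.
have [bb0 _ _] := moebius_sub hP hal dal v0 det.
have [C [D []]] := form_at_convergent k; move=> _ _ _.
have -> : clin k.+1 be = cerr q y k.+1 by rewrite clinE -xb subrr mulr0 subr0.
have [e0 ->] := cerr_deg hy k.+1.
have -> : clin k.+1 be' = - (pl (cden q k.+1) * (be - be')) + cerr q y k.+1.
  by rewrite clinE xb addrC.
have m0 : - (pl (cden q k.+1) * (be - be')) != 0.
  by rewrite oppr_eq0 mulf_neq0// (pcden_neq0 hy).
have dm : deg (- (pl (cden q k.+1) * (be - be'))) = cdeg q k + de.
  by rewrite degN degM// (pcden_neq0 hy).
have ck := cdeg_ge hy k; have cS := cdegS hy k.
have [|_ ->] := deg_lead m0 (dle_deg (cerr q y k.+1)).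
  by have [_ ->] := cerr_deg hy k.+1; rewrite dm cS; exact: aux' hk ck (dy k).
by rewrite dm cS -/de => /aux h _; exact: h.
Qed.

End Form.

End Approximation.

(** * The set [Theta] as the orbit of [al] alone *)

Lemma det_mx2 (R : comNzRingType) (g : 'M[R]_2) :
  \det g = g 0 0 * g 1 1 - g 0 1 * g 1 0.
Proof.
rewrite (expand_det_row _ 0) !big_ord_recl big_ord0 /cofactor !det_mx11 !mxE /=.
rewrite expr0 mul1r expr1 mulN1r mulrN addr0.
by congr (g _ _ * g _ _ - g _ _ * g _ _); exact/val_inj.
Qed.

Section ThetaOrbit.
Variables (F : finFieldType) (P : {poly F}).
Hypothesis hP : size P = 2%N.

Let al := cfrac (fun _ : nat => P).

Let sz (k : nat) : (1 < size ((fun _ : nat => P) k))%N. Proof. by rewrite hP. Qed.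

Lemma cfrac_const_eq : al = pl P + al^-1.
Proof. exact: (cfracS sz). Qed.

Lemma cfrac_const_deg : deg al = 1.
Proof.
have [al0 d] := cfrac_deg sz; rewrite -/al in al0 d.
have P0 : P != 0 by rewrite -size_poly_eq0 hP.
have dP : deg (pl P) = 1 by rewrite (deg_poly P0) hP.
rewrite cfrac_const_eq; have [|||_ ->] := @deg_lead F (pl P) al^-1 (- 1).
- by rewrite poly_laurent_neq0.
- exact: dle_inv_large.
- by rewrite dP.
by rewrite dP.
Qed.

Let hal := cfrac_const_eq.
Let dal := cfrac_const_deg.

(** [moebius_trace] and [moebius_norm] write the sum and the product as fractions of polynomials, as
    [gconjP] requires. *)
Lemma gconj_moebius (a b c d : {poly F}) (u : F) : u != 0 ->
  a * d - b * c = u%:P ->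
  gconj (moebius a b c d al) = moebius a b c d (al' al).
Proof.
move=> u0 det; have irr := moebius_irrational hP hal dal u0 det.
have [_ N0 _] := moebius_sub hP hal dal u0 det.
have pN0 : pl (nform P c d) != 0 by rewrite poly_laurent_neq0.
apply: (gconjP irr).
  exists (tofrac (- (a * c) *+ 2 + (a * d + b * c) * P + (b * d) *+ 2)
    / tofrac (nform P c d)) => //.
  rewrite frac_laurentE// -(moebius_trace hP hal dal u0 det).
  by rewrite mulfK.
exists (tofrac (nform P a b) / tofrac (nform P c d)) => //.
by rewrite frac_laurentE// -(moebius_norm hP hal dal u0 det) mulfK.
Qed.

Lemma ThetaP (be : laurent F) : Theta al be <->
  exists a b c d (u : F),
    [/\ u != 0, a * d - b * c = u%:P & be = moebius a b c d al].
Proof.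
have al0 := al_neq0 hP hal.
have e1 : moebius 1 0 0 1 al = al.
  by rewrite /moebius rmorph1 rmorph0 mul1r mul0r addr0 add0r divr1.
have galE : gconj al = al' al.
  rewrite -{1}e1 (gconj_moebius (u := 1)) ?oner_neq0//; last by ring.
  by rewrite /moebius rmorph1 rmorph0 mul1r mul0r addr0 add0r divr1.
split.
  case=> g; rewrite unitmxE poly_unitE => /andP[sg ug].
  have [u u0 eu] : exists2 u : F, u != 0 &
      g 0 0 * g 1 1 - g 0 1 * g 1 0 = u%:P.
    exists (\det g)`_0; first by rewrite -unitfE.
    by rewrite -det_mx2 -size1_polyC// (eqP sg).
  rewrite /homography galE /=; case; case: ifP => // _ [<-].
    by exists (g 0 0), (g 0 1), (g 1 0), (g 1 1), u.
  (* As [al' = -1/al], the image of the conjugate under the matrix with rows [(a, b)] and [(c, d)]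
     is the image of [al] under the one with rows [(b, -a)] and [(d, -c)], of the same
     determinant. *)
  exists (g 0 1), (- g 0 0), (g 1 1), (- g 1 0), u; split=> //.
    by rewrite -eu; ring.
  have E s t : pl s * al' al + pl t = (pl t * al - pl s) / al.
    by rewrite /al'; field.
  rewrite /moebius (raddfN _ (g 0 0)) (raddfN _ (g 1 0)) /= !E invf_div mulrA.
  by rewrite (divfK al0).
case=> a [b [c [d [u [u0 det ->]]]]].
pose g : 'M[{poly F}]_2 := \matrix_(i, j)
  if i == 0 then if j == 0 then a else b else if j == 0 then c else d.
exists g.
  rewrite unitmxE det_mx2 !mxE /= det poly_unitE size_polyC u0 coefC eqxx.
  by rewrite unitfE.
left.
rewrite /homography !mxE /=.
have := al_free hP hal dal (cd_neq0 u0 det).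
by move=> /negbTE ->.
Qed.

End ThetaOrbit.

(** * From degree bounds to the lower limit [approx_const] *)

Section ApproximationConstant.
Variables (R : realType) (F : finFieldType) (al x : laurent F).

Hypothesis Theta_sep : forall be, Theta al be -> be - gconj be != 0.
Hypothesis xTheta : ~ Theta al x.

(* Equivalent to [approx_const R al x <= q ^- (2 + n)]. *)
Definition approximable (n : nat) := forall N : int, exists be,
  [/\ Theta al be, deg (be - gconj be) < N &
      deg (x - be) - deg (be - gconj be) <= - (2 + n)%:Z].

Let q : R := #|F|%:R.
Let q1 : 1 < q. Proof. by rewrite ltr1n; exact: card_finNzRing_gt1. Qed.
Let q0 : 0 < q. Proof. exact: lt_trans ltr01 q1. Qed.

Let ratio be : \bar R := (labs R (x - be) / labs R (be - gconj be))%:E.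

Let ratioE be : Theta al be ->
  ratio be = (q ^ (deg (x - be) - deg (be - gconj be)))%:E.
Proof.
move=> hbe; have xb : x - be != 0.
  by rewrite subr_eq0; apply/eqP => e; apply: xTheta; rewrite e.
rewrite /ratio !labsE ?Theta_sep// -/q.
by rewrite invr_expz -expfzDr// gt_eqF.
Qed.

Let powN n : q ^- n = q ^ (- n%:Z). Proof. by rewrite -exprnN. Qed.

Let powN_lt (e : R) : 0 < e -> exists N : nat, q ^- N < e.
Proof.
move=> e0.
exists (Num.bound e^-1); rewrite invf_plt ?posrE ?exprn_gt0//.
have e'0 : 0 <= e^-1 by rewrite invr_ge0 ltW.
apply: lt_trans (archi_boundP e'0) _.
by rewrite /q -natrX ltr_nat ltn_expl// -(ltr_nat R).
Qed.

Lemma approx_const_le n : approximable n ->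
  (approx_const R al x <= (q ^- (2 + n))%:E)%E.
Proof.
move=> h; rewrite /approx_const limf_einfE; apply: ge_ereal_sup => _ /= [V [e /= e0 eV] <-].
have [N Ne] := powN_lt e0.
have [be [hbe dN dr]] := h (- N%:Z).
apply: (@le_trans _ _ (ratio be)).
  apply: ereal_inf_lbound; exists be => //; apply: eV; split=> //.
  rewrite labsE ?Theta_sep//; apply: lt_trans Ne.
  by rewrite powN ltr_eXz2l.
by rewrite ratioE// lee_fin powN ler_eXz2l.
Qed.

(** Below some threshold on [be - gconj be] every ratio exceeds [q ^- (3 + n)]; being a power of
    [q], it is at least [q ^- (2 + n)]. *)
Lemma approx_const_ge n : ~ approximable n.+1 ->
  ((q ^- (2 + n))%:E <= approx_const R al x)%E.
Proof.
move=> /existsNP[N hN]; rewrite /approx_const limf_einfE.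
apply: le_trans (ereal_sup_ubound _); last first.
  exists [set be | Theta al be /\ labs R (be - gconj be) < q ^ N] => //.
  by exists (q ^ N) => //=; rewrite exprz_gt0.
apply: le_ereal_inf_tmp => _ /= [be [hbe dN] <-].
rewrite -/(ratio be) ratioE// lee_fin powN ler_eXz2l//.
rewrite labsE ?Theta_sep// ltr_eXz2l// in dN.
by rewrite leNgt; apply/negP => lt; apply: hN; exists be; split.
Qed.

Lemma approx_const_ge0 : (0 <= approx_const R al x)%E.
Proof.
rewrite /approx_const limf_einfE.
apply: le_trans (ereal_sup_ubound _); last first.
  exists [set be | Theta al be /\ labs R (be - gconj be) < 1] => //.
  by exists 1 => //=; rewrite ltr01.
apply: le_ereal_inf_tmp => _ /= [be [hbe dN] <-].
by rewrite -/(ratio be) ratioE// lee_fin exprz_ge0// ltW.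
Qed.

Lemma approx_const_eq n : approximable n -> ~ approximable n.+1 ->
  approx_const R al x = (q ^- (2 + n))%:E.
Proof.
by move=> h1 h2; apply/eqP; rewrite eq_le approx_const_le// approx_const_ge.
Qed.

Lemma approx_const_eq0 : (forall n, approximable n) -> approx_const R al x = 0%E.
Proof.
move=> h; apply/eqP; rewrite eq_le approx_const_ge0 andbT.
apply/lee_addgt0Pr => e e0; rewrite add0e.
have [N Ne] := powN_lt e0.
apply: le_trans (approx_const_le (h N)) _.
rewrite lee_fin; apply: le_trans (ltW Ne).
by rewrite !powN ler_eXz2l// lerN2 lez_nat leq_addl.
Qed.

(** If some level fails, descending from it meets a level that holds just below one that fails;
    level 0 stops the descent. *)
Lemma approx_const_values : approximable 0 -> approx_const R al x = 0%E \/
  exists n : nat, approx_const R al x = (q ^- (2 + n))%:E.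
Proof.
move=> h0; have [h|] := pselect (forall n, approximable n).
  by left; exact: approx_const_eq0.
move=> /existsNP[n hn]; right; elim: n hn => [//|n IH hn].
have [h|/IH//] := pselect (approximable n).
by exists n; exact: approx_const_eq.
Qed.

End ApproximationConstant.

(** * Agreement exponents for prescribed partial quotients *)

Section Patterns.
Variables (F : fieldType) (P : {poly F}) (al : laurent F).
Hypotheses (hP : size P = 2%N) (hal : al = pl P + al^-1) (dal : deg al = 1).
Variables (q : nat -> {poly F}) (y : nat -> laurent F).
Hypothesis hy : complete_quotients q y.
Hypothesis y_neq : forall k (u : F), u != 0 -> y k.+1 - pl u%:P * al != 0.

Let fwd := fwd al y.
Let bwd := bwd al q.

Let fbig := fwd_big hP hal dal hy.
Let bbig := bwd_big hP hal dal hy.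

Lemma size_large_sub (p : {poly F}) (u : F) : (2 < size p)%N ->
  (1 < size (p - u *: P)%R)%N.
Proof.
move=> sp; rewrite size_polyDl; first exact: ltn_trans sp.
by rewrite size_polyN; apply: leq_ltn_trans (size_scale_leq _ _) _; rewrite hP.
Qed.

Lemma size_prop_sub (u : F) : u != 1 -> size (P - u *: P) = 2%N.
Proof.
move=> u1; rewrite -{1}[P]scale1r -scalerBl size_scale// subr_eq0 eq_sym.
exact: u1.
Qed.

Lemma fwd_large (u : F) k : u != 0 -> (2 < size (q k.+1))%N -> fwd u k = 0.
Proof. by move=> u0 /size_large_sub h; apply: fbig. Qed.

Lemma bwd_large (u : F) k : u != 0 -> (2 < size (q k.+1))%N -> bwd u k.+1 = 0.
Proof. by move=> u0 /size_large_sub h; apply: bbig. Qed.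

Lemma fwd_P k : q k.+1 = P -> fwd 1 k = fwd 1 k.+1 - 2.
Proof.
move=> h; rewrite -[in RHS](invr1 F); apply: (fwd_eq hP hal dal hy y_neq).
  exact: oner_neq0.
by rewrite scale1r.
Qed.

Lemma fwd_run k j : (forall i, (i < j)%N -> q (k + i).+1 = P) ->
  fwd 1 k = fwd 1 (k + j) - 2 * j%:Z.
Proof.
elim: j => [|j IH] h; first by rewrite addn0 mulr0 subr0.
rewrite IH; last by move=> i ij; apply: h; exact: ltnW.
by rewrite fwd_P ?h// addnS; lia.
Qed.

(** At a quotient [P] only [u = 1] prolongs the agreement: for other [u], [P - u P] is nonconstant
    and the exponent is 0. *)
Lemma fwd_P_ge (L : int) k : q k.+1 = P -> L <= 0 ->
  (forall u : F, u != 0 -> L <= fwd u k.+1) -> forall u : F, u != 0 -> L - 2 <= fwd u k.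
Proof.
move=> h L0 hL u u0; have [->|u1] := eqVneq u 1.
  by rewrite fwd_P// lerD2r; apply: hL; exact: oner_neq0.
by rewrite /fwd fbig ?h ?size_prop_sub//; lia.
Qed.

Lemma bwd_P_ge (L : int) k : q k.+1 = P -> L <= 0 ->
  (forall u : F, u != 0 -> L <= bwd u k) -> forall u : F, u != 0 -> L - 2 <= bwd u k.+1.
Proof.
move=> h L0 hL u u0; have [->|u1] := eqVneq u 1.
  rewrite /bwd (bwd_eq hP hal dal hy) ?invr1 ?scale1r ?oner_neq0//.
  by rewrite lerD2r; apply: hL; exact: oner_neq0.
by rewrite /bwd bbig ?h ?size_prop_sub ?invr_eq1//; lia.
Qed.

(** Agreement continues backwards only through a quotient equal to [P]; a difference that is a
    nonzero constant costs 1, any other nonzero one costs nothing. *)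
Lemma bwd_nP_ge k : q k.+1 != P -> - 1 <= bwd 1 k.+1.
Proof.
move=> h; have [h1|h1] := leqP (size (q k.+1 - 1^-1 *: P)) 1.
  rewrite /bwd (bwd_const hP hal dal hy) ?oner_neq0//.
  apply/eqP; rewrite eqn_leq h1 size_poly_gt0 subr_eq0 invr1 scale1r.
  exact: h.
by rewrite /bwd bbig ?oner_neq0.
Qed.

(** * Periodic expansions: [W], then [m] copies of [P], then [E] *)

Section Period.
Variables (m e : nat) (W E : {poly F}).
Hypotheses (sW : (2 < size W)%N)
  (hE : [/\ e = 0%N & (2 < size E)%N] \/ e = 1%N /\ E = P + 1).
Hypothesis hq : forall t j, (j < m.+2)%N ->
  q (t * m.+2 + j)%N = if j == 0%N then W else if j == m.+1 then E else P.

Let size_PD1 : size (P + 1 - 1 *: P) = 1%N.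
Proof. by rewrite scale1r addrAC subrr add0r size_poly1. Qed.

Let size_PD1u (u : F) : u != 1 -> (1 < size (P + 1 - u *: P)%R)%N.
Proof.
move=> u1; rewrite addrAC size_polyDl size_prop_sub//.
by rewrite size_poly1.
Qed.

Let fwd_E (u : F) k : u != 0 -> q k.+1 = E -> - e%:Z <= fwd u k.
Proof.
move=> u0 h; case: hE => [[-> sE]|[-> eE]].
  by rewrite fwd_large ?h.
have [->|u1] := eqVneq u 1.
  by rewrite /fwd (fwd_const hP hal dal hy) ?oner_neq0 ?h ?eE.
by rewrite /fwd fbig ?h ?eE ?size_PD1u.
Qed.

Let fwd_E1 k : q k.+1 = E -> fwd 1 k <= - e%:Z.
Proof.
move=> h; case: hE => [[-> sE]|[-> eE]].
  by rewrite fwd_large ?h ?oner_neq0.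
by rewrite /fwd (fwd_const hP hal dal hy) ?oner_neq0 ?h ?eE.
Qed.

Let bwd_E (u : F) k : u != 0 -> q k.+1 = E -> - e%:Z <= bwd u k.+1.
Proof.
move=> u0 h; case: hE => [[-> sE]|[-> eE]].
  by rewrite bwd_large ?h.
have [->|u1] := eqVneq u 1.
  by rewrite /bwd (bwd_const hP hal dal hy) ?oner_neq0 ?h ?eE ?invr1.
by rewrite /bwd bbig ?h ?eE ?size_PD1u ?invr_eq1.
Qed.

(** After this index come [i] copies of [P], each contributing -2 when [u = 1], and then [E],
    contributing [- e]. *)
Lemma period_fwd t i : (i <= m)%N ->
  (forall u : F, u != 0 -> - (2 * i + e)%:Z <= fwd u (t * m.+2 + (m - i))) /\
  fwd 1 (t * m.+2 + (m - i)) <= - (2 * i + e)%:Z.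
Proof.
elim: i => [|i IH] im.
  have h : q (t * m.+2 + (m - 0)).+1 = E by rewrite subn0 -addnS hq// eqxx.
  by split=> [u u0|]; [exact: fwd_E|exact: fwd_E1].
have [IH1 IH2] := IH (ltnW im).
have nx : (t * m.+2 + (m - i.+1)).+1 = (t * m.+2 + (m - i))%N by lia.
have h : q (t * m.+2 + (m - i.+1)).+1 = P.
  rewrite nx hq; last by lia.
  by rewrite !ifF//; apply/negbTE; lia.
split=> [u u0|].
  have := fwd_P_ge h (L := - (2 * i + e)%:Z); rewrite nx => /(_ _ IH1 u u0) h'.
  by apply: le_trans (h' _); lia.
by rewrite (fwd_P h) nx; lia.
Qed.

(** The [j] copies of [P] read backwards are stopped by [W]; in the first period [bwd0] plays that
    part. *)
Lemma period_bwd t j : (j <= m)%N ->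
  forall u : F, u != 0 -> - (2 * j)%:Z <= bwd u (t * m.+2 + j).
Proof.
elim: j => [|j IH] jm u u0.
  case: t => [|t]; first by rewrite mul0n addn0 /bwd bwd0.
  have h : q (t.+1 * m.+2 + 0) = W by rewrite hq.
  move: h; rewrite (_ : (t.+1 * m.+2 + 0 = (t * m.+2 + m.+1).+1)%N); last by lia.
  by move=> h; rewrite bwd_large ?h.
have h : q (t * m.+2 + j).+1 = P.
  rewrite -addnS hq; last by lia.
  by rewrite !ifF//; apply/negbTE; lia.
have := bwd_P_ge h (L := - (2 * j)%:Z); rewrite addnS => /(_ _ (IH (ltnW jm)) u u0) h'.
by apply: le_trans (h' _); lia.
Qed.

(** At an offset [j <= m] the two directions share the [m] copies of [P] and one [E]; at offset
    [m.+1] the next quotient is [W], and looking back only [E] counts. *)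
Lemma period_sum (u : F) k : u != 0 -> - (2 * m + e)%:Z <= fwd u k + bwd u k.
Proof.
move=> u0; have jm : (k %% m.+2 < m.+2)%N by rewrite ltn_mod.
rewrite (divn_eq k m.+2); move: (k %/ _)%N (k %% _)%N jm => t j.
rewrite ltnS leq_eqVlt => /predU1P[->|jm].
  rewrite fwd_large//; last first.
    rewrite (_ : (t * m.+2 + m.+1).+1 = (t.+1 * m.+2 + 0)%N); last by lia.
    by rewrite hq.
  rewrite addnS add0r; apply: le_trans (bwd_E u0 _); first by lia.
  by rewrite -addnS hq// eqxx.
have := period_bwd t jm u0.
have [/(_ u u0)] := @period_fwd t (m - j) (leq_subr _ _).
by rewrite subKn//; lia.
Qed.

Lemma period_start t : (2 < size (q (t.+1 * m.+2)))%N /\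
  fwd 1 (t.+1 * m.+2) <= - (2 * m + e)%:Z.
Proof.
have [_] := period_fwd t.+1 (leqnn m); rewrite subnn addn0; split=> //.
by rewrite -[(_ * _)%N]addn0 hq.
Qed.

End Period.

End Patterns.

(** * Reading approximability off the expansion *)

Section Criteria.
Variables (F : finFieldType) (P : {poly F}).
Hypothesis hP : size P = 2%N.

Let al := cfrac (fun _ : nat => P).
Let hal : al = pl P + al^-1. Proof. exact: cfrac_const_eq. Qed.
Let dal : deg al = 1. Proof. exact: cfrac_const_deg. Qed.

Lemma Theta_separated be : Theta al be -> be - gconj be != 0.
Proof.
move=> /(ThetaP hP)[a [b [c [d [u [u0 det ->]]]]]].
rewrite (gconj_moebius hP u0 det).
by have [] := moebius_sub hP hal dal u0 det.
Qed.

Variables (q : nat -> {poly F}) (y : nat -> laurent F).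
Hypothesis hy : complete_quotients q y.

Lemma cf_point_Theta (u : F) k : u != 0 -> Theta al (cf_point q u k al) /\
  gconj (cf_point q u k al) = cf_point q u k (al' al).
Proof.
move=> u0; have s0 := cf_point_det_neq0 k u0; have det := cf_point_det q u k.
split; last exact: gconj_moebius det.
apply/(ThetaP hP); exists (cnum q k.+1 * u%:P), (cnum q k),
  (cden q k.+1 * u%:P), (cden q k), ((-1) ^+ k.+1 * u).
by split.
Qed.

(** By [in_orbit_deg], complete quotients of an orbit point eventually have degree at most 1. *)
Lemma not_Theta_of_large :
  (forall K, exists2 k, (K <= k)%N & (2 < size (q k.+1))%N) -> ~ Theta al (y 0%N).
Proof.
move=> large /(ThetaP hP)[a [b [c [d [u [u0 det e]]]]]].
have [K hK] := in_orbit_deg hP hal dal hy u0 det e.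
have [k /hK dk sk] := large K.
have sy : (size (q k.+1))%:Z = deg (y k.+1) + 1 := size_pquot hy k.
have : 3%:Z <= (size (q k.+1))%:Z by rewrite lez_nat.
by rewrite sy; move: dk; move: (deg _); clear; lia.
Qed.

Hypothesis yT : ~ Theta al (y 0%N).

Lemma cquot_neq k (u : F) : u != 0 -> y k.+1 - pl u%:P * al != 0.
Proof.
move=> u0; apply/eqP => /eqP; rewrite subr_eq0 => /eqP e; apply: yT.
have [h _] := cf_point_Theta k u0.
suff -> : y 0%N = cf_point q u k al by [].
by rewrite (cquot_homography hy k) e /cf_point /moebius !rmorphM /= !mulrA.
Qed.

(** A ratio violating the claim is at most [q ^- 3], so [close_is_approx] makes the point a
    [cf_point], and [cf_point_ratio] contradicts the bound. *)
Lemma not_approximable n :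
  (forall (u : F) k, u != 0 -> - n%:Z <= fwd al y u k + bwd al q u k) ->
  ~ approximable al (y 0%N) n.+1.
Proof.
(* The threshold 1 yields degree at most 0 for [be - gconj be], as [close_is_approx] requires. *)
move=> h /(_ 1)[be [hbe dN dr]].
have xb : y 0%N - be != 0.
  by rewrite subr_eq0; apply/eqP => e; apply: yT; rewrite e.
have le3 (s : int) : s <= - (2 + n.+1)%:Z -> s <= - 3 by clear; lia.
have [a [b [c [d [v [v0 det e]]]]]] := (ThetaP hP be).1 hbe.
have e' := gconj_moebius hP v0 det; rewrite -e in e'.
have bb0 : deg (be - gconj be) <= 0 by rewrite -ltzD1.
have := close_is_approx hP hal dal hy v0 det; rewrite -e -e'.
move=> /(_ xb bb0 (le3 _ dr))[u u0 [k eb]].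
have [_ eg] := cf_point_Theta k u0.
have [_ E] := cf_point_ratio hP hal dal hy u0 (cquot_neq k u0).
move: dr; rewrite eb eg E; have := h u k u0.
by move: (fwd _ _ _ _) (bwd _ _ _ _); clear; lia.
Qed.

(** Take [cf_point] with [u = 1] at index [k.+1]. The quotient different from [P] keeps the backward
    exponent between -1 and 0, so the distance to the conjugate tends to 0 while the forward
    exponent alone gives the ratio. *)
Lemma approximable_of_fwd n :
  (forall K, exists k, [/\ (K <= k)%N, q k.+1 != P & fwd al y 1 k.+1 <= - n%:Z]) ->
  approximable al (y 0%N) n.
Proof.
move=> h N; have [k [Kk qk fk]] := h `|N|.+3.
have [hT hg] := cf_point_Theta k.+1 (oner_neq0 F).
have b1 := bwd_nP_ge hP hal dal hy qk.
have b0 := bwd_le0 hP hal dal hy k.+1 (oner_neq0 F).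
have ck := cdeg_ge hy k.+1.
have dd := cf_point_deg hP hal dal hy k.+1 (oner_neq0 F).
have [_ r] := cf_point_ratio hP hal dal hy (oner_neq0 F) (cquot_neq k.+1 (oner_neq0 F)).
exists (cf_point q 1 k.+1 al); rewrite hg; split=> //.
  rewrite dd; move: b1 ck Kk; move: (bwd _ _ _ _) (cdeg _ _); clear; lia.
by rewrite r; move: b0 fk; move: (bwd _ _ _ _) (fwd _ _ _ _); clear; lia.
Qed.

(** If all quotients after some index were [P], [fwd_run] would push the forward exponent at that
    index below every bound; otherwise [fwd_le0] suffices. *)
Lemma approximable0 : approximable al (y 0%N) 0.
Proof.
have f0 k := fwd_le0 hP hal dal hy cquot_neq k (oner_neq0 F).
apply: approximable_of_fwd => K.
have [[k [Kk qk]]|h] := pselect (exists k, (K <= k)%N /\ q k.+1 != P).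
  by exists k; split=> //; rewrite oppr0.
have run j : fwd al y 1 K = fwd al y 1 (K + j) - 2 * j%:Z.
  apply: (fwd_run hP hal dal hy cquot_neq) => i _; apply/eqP.
  by apply: contrapT => /negP qi; apply: h; exists (K + i)%N; rewrite leq_addr.
have aux (s t : int) : t <= 0 -> s = t - 2 * `|s|.+1%:Z -> False by clear; lia.
by case: (aux _ _ (f0 _) (run `|fwd al y 1 K|.+1)).
Qed.

End Criteria.

(** * Both inclusions, with explicit expansions realizing each value *)

Theorem theorem4p11 (R : realType) (F : finFieldType) (P : {poly F})
    (hP : size P = 2%N) :
  spectrum R (cfrac (fun _ : nat => P)) =
  [set 0%E] `|` [set ((#|F|%:R : R) ^- (2 + n))%:E | n in [set: nat]].
Proof.
have sep := Theta_separated hP.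
have sW : (2 < size (P ^+ 2))%N.
  by rewrite expr2 size_proper_mul ?hP// mulf_neq0 ?lead_coef_eq0 -?size_poly_eq0 ?hP.
(* Turns any expansion with infinitely many quotients of degree at least 2 into a point whose
   constant belongs to the spectrum. *)
have cfT (q : nat -> {poly F}) : (forall k, (1 < size (q k))%N) ->
    (forall K, exists2 k, (K <= k)%N & (2 < size (q k.+1))%N) ->
    exists y, [/\ complete_quotients q y,
      ~ Theta (cfrac (fun=> P)) (y 0%N) &
      forall c, approx_const R (cfrac (fun=> P)) (y 0%N) = c ->
      spectrum R (cfrac (fun=> P)) c].
  move=> hq /(not_Theta_of_large hP) large.
  have hy := cfrac_complete_quotients hq.
  have yT := large _ hy.
  exists (fun k => cfrac (fun i => q (i + k)%N)); split=> // c <-.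
  eexists; last by reflexivity.
  move=> [/range_fracP|]; last exact: yT.
  by apply=> n d d0; exact: (cf_irrational hy).
apply/seteqP; split=> c.
  case=> x xT <-.
  have irr : irrational_series x.
    by apply: contrapT => /range_fracP xr; apply: xT; left.
  have xT' : ~ Theta (cfrac (fun=> P)) x by move=> h; apply: xT; right.
  have [q [y [yx hy]]] := complete_quotients_exist irr.
  rewrite -yx in xT' *.
  have [->|[n ->]] := approx_const_values R sep xT' (approximable0 hP hy xT').
    by left.
  by right; exists n.
case=> [->|[n _ <-]].
  (* For the value 0, [P ^+ 2] stands exactly at the powers of two, so the blocks of [P] grow
     without bound. Searching [i <= k] suffices because [i < 2 ^ i]. *)
  pose q k := if [exists i : 'I_k.+1, k == 2 ^ i]%N then P ^+ 2 else P.
  have q1 i : q (2 ^ i)%N = P ^+ 2.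
    rewrite /q; case: ifP => // /negbT/existsPn /(_ (Ordinal _)).
    have h : (i < (2 ^ i).+1)%N by rewrite ltnS ltnW// ltn_expl.
    by move=> /(_ _ h) /=; rewrite eqxx.
  have q2 i k : (2 ^ i < k < 2 ^ i.+1)%N -> q k = P.
    move=> /andP[h1 h2]; rewrite /q; case: ifP => // /existsP[j /eqP ej].
    by move: h1 h2; rewrite ej !ltn_exp2l//; lia.
  have hq k : (1 < size (q k))%N.
    by rewrite /q; case: ifP => _; [exact: ltnW|rewrite hP].
  have [|y [hy yT]] := cfT q hq.
    move=> K; exists (2 ^ K).-1.
      by rewrite -ltnS prednK ?expn_gt0// ltn_expl.
    by rewrite prednK ?expn_gt0// q1.
  apply; apply: (approx_const_eq0 R sep yT) => n.
  apply: (approximable_of_fwd hP hy yT) => K.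
  (* Large enough for [2 ^ i] to pass [K] and for the next block, of [2 ^ i - 1] copies of [P], to
     reach level [n]. *)
  pose i := (K + n).+1.
  have hi : (i < 2 ^ i)%N by rewrite ltn_expl.
  exists (2 ^ i).-1; rewrite prednK ?expn_gt0//; split.
  - by rewrite -ltnS prednK ?expn_gt0//; move: hi; rewrite /i; lia.
  - rewrite q1; apply/eqP => e; by move: sW; rewrite e hP.
  have run := fwd_run hP (cfrac_const_eq hP) (cfrac_const_deg hP) hy
    (cquot_neq hP hy yT) (k := 2 ^ i) (j := (2 ^ i).-1).
  rewrite run; last first.
    move=> j hj; apply: (q2 i); rewrite expnS; lia.
  have := fwd_le0 hP (cfrac_const_eq hP) (cfrac_const_deg hP) hy (cquot_neq hP hy yT)
    (2 ^ i + (2 ^ i).-1) (oner_neq0 F).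
  by move: (fwd _ _ _ _) hi; rewrite /i; move: (2 ^ _)%N; clear; lia.
(* Each of the [m] copies of [P] accounts for 2 in the exponent; for odd [n], the quotient [P + 1]
   supplies the remaining 1. *)
pose m := n./2; pose e : nat := odd n.
have nE : n = (2 * m + e)%N by rewrite -[LHS]odd_double_half /e /m; lia.
pose E := if odd n then P + 1 else P ^+ 2.
have hE : [/\ e = 0%N & (2 < size E)%N] \/ e = 1%N /\ E = P + 1.
  by rewrite /e /E; case: odd; [right|left].
pose q k := if (k %% m.+2 == 0)%N then P ^+ 2
  else if (k %% m.+2 == m.+1)%N then E else P.
have qE t j : (j < m.+2)%N -> q (t * m.+2 + j)%N =
    if j == 0%N then P ^+ 2 else if j == m.+1 then E else P.
  by move=> jm; rewrite /q modnMDl modn_small.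
have hq k : (1 < size (q k))%N.
  rewrite /q; case: ifP => _; first exact: ltnW.
  case: ifP => _; last by rewrite hP.
  case: hE => [[_ /ltnW//]|[_ ->]].
  by rewrite size_polyDl hP// size_poly1.
have start t : q (t * m.+2)%N = P ^+ 2 by rewrite -[(_ * _)%N]addn0 qE.
have [|y [hy yT]] := cfT q hq.
  move=> K; exists (K.+1 * m.+2).-1; first by lia.
  by rewrite prednK// start.
have yn := cquot_neq hP hy yT.
have hal := cfrac_const_eq hP; have dal := cfrac_const_deg hP.
apply; apply: (approx_const_eq R sep yT).
  apply: (approximable_of_fwd hP hy yT) => K.
  exists (K.+1 * m.+2).-1; rewrite prednK//; split; first by lia.
    by rewrite start; apply/eqP => e'; move: sW; rewrite e' hP.
  by have [_] := period_start hP hal dal hy yn sW hE qE K; rewrite nE.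
apply: (not_approximable hP hy yT) => u k u0.
by have := period_sum hP hal dal hy yn sW hE qE k u0; rewrite nE.
Qed.
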